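(* Let $A$ be a Banach algebra, and let $X$ be a left Banach $A$-module. Then the following conditions are equivalent: (i) for every exact sequence $0\to Y_1\to Y_2\to Y_3\to0$ of right Fréchet $A$-modules and continuous module maps, the sequence $0\to Y_1\mathbin{\widehat\otimes}_A X\to Y_2\mathbin{\widehat\otimes}_A X\to Y_3\mathbin{\widehat\otimes}_A X\to0$ is exact in the category of vector spaces (i.e. $X$ is strictly flat as a Fréchet $A$-module); (ii) for every exact sequence $0\to Y_1\to Y_2\to Y_3\to0$ of right Banach $A$-modules and continuous module maps, the sequence $0\to Y_1\mathbin{\widehat\otimes}_A X\to Y_2\mathbin{\widehat\otimes}_A X\to Y_3\mathbin{\widehat\otimes}_A X\to0$ is exact in the category of vector spaces (i.e. $X$ is strictly flat as a Banach $A$-module).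
   Context: All spaces are over $\mathbb C$. A (left or right) Fréchet (Banach) $A$-module is a Fréchet (Banach) space with a jointly continuous $A$-module structure. Exactness of sequences of modules is algebraic exactness. $\widehat\otimes$ is the completed projective tensor product; for a right module $Y$ and a left module $X$, $Y\mathbin{\widehat\otimes}_A X=(Y\mathbin{\widehat\otimes}X)/N$, where $N$ is the closed linear span of all $y\cdot a\otimes x-y\otimes a\cdot x$ ($y\in Y$, $x\in X$, $a\in A$). *)

(* Defs.v *)
From HB Require Import structures.
From mathcomp Require Import all_boot all_order all_algebra.
From mathcomp Require Import generic_quotient ring_quotient.
From mathcomp Require Import complex.
From mathcomp Require Import boolp classical_sets functions reals convex.
From mathcomp Require Import interval_inference topology normedtype.
From mathcomp Require Import freeg ring.

Set Implicit Arguments.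
Unset Strict Implicit.
Unset Printing Implicit Defensive.

Import Order.TTheory GRing.Theory Num.Theory.
Import numFieldNormedType.Exports.

Local Open Scope classical_set_scope.
Local Open Scope ring_scope.

Section LinearQuotient.
Context (K : nzRingType) (V : lmodType K).

Definition submodule (W : set V) : Prop :=
  [/\ W 0, forall v w, W v -> W w -> W (v + w) &
      forall (k : K) v, W v -> W (k *: v)].

Definition lspan (S : set V) : set V :=
  [set v | forall W : set V, submodule W -> S `<=` W -> W v].

Lemma lspan_submodule (S : set V) : submodule (lspan S).
Proof.
split=> [W [] //|v w Sv Sw W Wm SW|k v Sv W Wm SW]; have [W0 WD WZ] := Wm.
- by apply: WD; [exact: Sv|exact: Sw].
- by apply: WZ; exact: Sv.
Qed.

Lemma sub_lspan (S : set V) : S `<=` lspan S.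
Proof. by move=> v Sv W _ /(_ _ Sv). Qed.

Lemma lspan_id (W : set V) : submodule W -> lspan W = W.
Proof.
by move=> Wm; apply/seteqP; split=> [v /(_ W Wm)|]; [apply|exact: sub_lspan].
Qed.

Definition lspan_pred (S : set V) : {pred V} := fun v => `[< lspan S v >].

Lemma lspan_pred_closed (S : set V) : submod_closed (lspan_pred S).
Proof.
have [S0 SD SZ] := lspan_submodule S.
split=> [|k v w]; first exact/asboolP.
move=> /asboolP Sv /asboolP Sw; apply/asboolP.
by apply: SD Sw; apply: SZ Sv.
Qed.

HB.instance Definition _ (S : set V) :=
  GRing.isSubmodClosed.Build K V (lspan_pred S) (lspan_pred_closed S).

(* V modulo the span of S, for an arbitrary subset S. *)
Definition lquot (S : set V) : Type := Quotient.quot (lspan_pred S).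

End LinearQuotient.

Section LinearQuotientModule.
Context (K : nzRingType) (V : lmodType K) (S : set V).

HB.instance Definition _ := GRing.Zmodule.on (lquot S).

Definition lproj (v : V) : lquot S := (\pi_(Quotient.quot (lspan_pred S)) v)%qT.
Definition lrepr (z : lquot S) : V :=
  @generic_quotient.repr _ (Quotient.quot (lspan_pred S)) z.

Lemma lreprK z : lproj (lrepr z) = z.
Proof. exact: reprK. Qed.

Lemma lprojP v w : lproj v = lproj w <-> lspan S (v - w).
Proof.
rewrite /lproj; split.
  by move/eqP; rewrite -Quotient.idealrBE => /asboolP.
by move=> Svw; apply/eqP; rewrite -Quotient.idealrBE; exact/asboolP.
Qed.

Lemma lprojD v w : lproj (v + w) = lproj v + lproj w.
Proof. exact: (Quotient.pi_add (lspan_pred S)). Qed.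

Definition lquot_scale (k : K) (z : lquot S) : lquot S := lproj (k *: lrepr z).

Lemma lquot_scaleE k v : lquot_scale k (lproj v) = lproj (k *: v).
Proof.
apply/lprojP; rewrite -scalerBr; have [_ _ SZ] := lspan_submodule S.
by apply: SZ; apply/lprojP; rewrite lreprK.
Qed.

Lemma lquot_scalerA a b z :
  lquot_scale a (lquot_scale b z) = lquot_scale (a * b) z.
Proof. by rewrite -(lreprK z) !lquot_scaleE scalerA. Qed.

Lemma lquot_scale1r : left_id 1 lquot_scale.
Proof. by move=> z; rewrite -(lreprK z) lquot_scaleE scale1r. Qed.

Lemma lquot_scalerDr : right_distributive lquot_scale +%R.
Proof.
move=> k z t; rewrite -(lreprK z) -(lreprK t).
by rewrite !lquot_scaleE -!lprojD !lquot_scaleE scalerDr.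
Qed.

Lemma lquot_scalerDl z : {morph lquot_scale^~ z : a b / a + b}.
Proof.
by move=> a b; rewrite -(lreprK z) !lquot_scaleE -lprojD scalerDl.
Qed.

HB.instance Definition _ := GRing.Zmodule_isLmodule.Build K (lquot S)
  lquot_scalerA lquot_scale1r lquot_scalerDr lquot_scalerDl.

Lemma lproj_is_linear : linear lproj.
Proof. by move=> k v w; rewrite lprojD -lquot_scaleE. Qed.

HB.instance Definition _ :=
  GRing.isLinear.Build K V (lquot S) *:%R lproj lproj_is_linear.

Lemma lproj0 v : lproj v = 0 <-> lspan S v.
Proof. by rewrite -(linear0 lproj) -[v in lspan S v]subr0; exact: lprojP. Qed.

End LinearQuotientModule.

(* The map induced on quotients by a linear h; it is meaningful when h maps
   S into the span of T, see [lquot_mapE]. *)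
Definition lquot_map (K : nzRingType) (V W : lmodType K) (S : set V)
  (T : set W) (h : V -> W) (z : lquot S) : lquot T := lproj T (h (lrepr z)).

Section LinearQuotientMap.
Context (K : nzRingType) (V W : lmodType K) (S : set V) (T : set W).
Context (h : {linear V -> W}) (hST : forall v, S v -> lspan T (h v)).

Lemma lquot_mapE v : lquot_map T h (lproj S v) = lproj T (h v).
Proof.
apply/lprojP; rewrite -linearB.
have : lspan S (lrepr (lproj S v) - v) by apply/lprojP; rewrite lreprK.
move=> /(_ [set u | lspan T (h u)]); apply => //.
have [T0 TD TZ] := lspan_submodule T.
split=> /= [|u w Tu Tw|k u Tu]; first by rewrite linear0.
- by rewrite linearD; exact: TD.
- by rewrite linearZ; exact: TZ.
Qed.

Lemma lquot_map_is_linear : linear (lquot_map T h : lquot S -> lquot T).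
Proof.
move=> k z t; rewrite -(lreprK z) -(lreprK t) -linearP !lquot_mapE.
by rewrite linearP linearP.
Qed.

End LinearQuotientMap.

(* Absolutely convex = convex and balanced; a nonempty such set contains 0. *)
Definition absconvex (K : numDomainType) (V : lmodType K) (C : set V) : Prop :=
  forall (a b : K) v w, `|a| + `|b| <= 1 -> C v -> C w -> C (a *: v + b *: w).

Definition absconvex_hull (K : numDomainType) (V : lmodType K) (S : set V) :
  set V := [set v | forall C, absconvex C -> S `<=` C -> C v].

Lemma absconvex_hull_absconvex (K : numDomainType) (V : lmodType K)
  (S : set V) : absconvex (absconvex_hull S).
Proof.
by move=> a b v w ab Sv Sw C aC SC; exact: (aC _ _ _ _ ab (Sv C aC SC) (Sw C aC SC)).
Qed.

Lemma sub_absconvex_hull (K : numDomainType) (V : lmodType K)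
  (S : set V) : S `<=` absconvex_hull S.
Proof. by move=> v Sv C _ /(_ _ Sv). Qed.

Lemma absconvex_hull_sub (K : numDomainType) (V : lmodType K)
  (S C : set V) : absconvex C -> S `<=` C -> absconvex_hull S `<=` C.
Proof. by move=> aC SC v /(_ C aC SC). Qed.

Section AbsConvex.
Context (K : numFieldType) (V : lmodType K) (C : set V) (aC : absconvex C).

Lemma absconvex0 v : C v -> C 0.
Proof.
move=> Cv; have := @aC 0 0 v v; rewrite !scale0r addr0; apply => //.
by rewrite normr0 addr0.
Qed.

Lemma absconvexZ k v : `|k| <= 1 -> C v -> C (k *: v).
Proof.
move=> k1 Cv; have := @aC k 0 v v; rewrite scale0r addr0; apply => //.
by rewrite normr0 addr0.
Qed.

Lemma absconvex_half v w : C (2 *: v) -> C (2 *: w) -> C (v + w).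
Proof.
move=> Cv Cw; have := @aC 2^-1 2^-1 (2 *: v) (2 *: w).
rewrite !scalerA mulVf ?pnatr_eq0// !scale1r; apply => //.
by rewrite ger0_norm ?invr_ge0// -[2^-1]mul1r -splitr.
Qed.

Lemma absconvex_preimage (W : lmodType K) (h : {linear W -> V}) :
  absconvex (h @^-1` C).
Proof. by move=> a b v w ab /= Cv Cw; rewrite linearD !linearZ; exact: aC. Qed.

Lemma absconvex_preimageZ (r : K) : absconvex [set v | C (r *: v)].
Proof.
by move=> a b v w ab /= Cv Cw; rewrite scalerDr !scalerA ![r * _]mulrC -!scalerA; exact: aC.
Qed.

Lemma conv_translate (l : K) (y z t x : V) (c := l *: y + (1 - l) *: z) :
  l *: (y + (t - c) - x) + (1 - l) *: (z + (t - c) - x) = t - x.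
Proof.
have dE : c + (t - c - x) = t - x by rewrite addrA [c + _]addrC subrK.
rewrite -[y + _ - x]addrA -[z + _ - x]addrA -dE; move: (t - c - x) => d.
by rewrite !scalerDr addrACA -scalerDl [l + _]addrC subrK scale1r.
Qed.

End AbsConvex.

(* A base at 0 of absolutely convex absorbing sets, stable under scaling,
   defines a locally convex topology. *)
HB.factory Record Lmodule_isLocallyConvex (K : numFieldType) E
    & GRing.Lmodule K E := {
  base0 : set_system E;
  base0_neq0 : exists U, base0 U;
  base0_I : forall U V, base0 U -> base0 V ->
    exists2 W, base0 W & W `<=` U `&` V;
  base0_scale : forall (r : K) U, 0 < r -> base0 U ->
    exists2 W, base0 W & forall w, W w -> U (r *: w);
  base0_absconvex : forall U, base0 U -> absconvex U;
  base0_absorbing : forall U v, base0 U -> exists2 r : K, 0 < r & U (r *: v)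
}.

HB.builders Context K E & Lmodule_isLocallyConvex K E.

Definition lc_nbhs (x : E) : set_system E :=
  filter_from base0 (fun U => [set y | U (y - x)]).

HB.instance Definition _ := hasNbhs.Build E lc_nbhs.

Let lc_nbhsE (x : E) : nbhs x = lc_nbhs x. Proof. by []. Qed.

Let base00 U : base0 U -> U 0.
Proof.
by move=> bU; have [r _ Ur] := base0_absorbing 0 bU; exact: (absconvex0 (base0_absconvex bU) Ur).
Qed.

Let lc_double U : base0 U ->
  exists2 W, base0 W & forall v w, W v -> W w -> U (v + w).
Proof.
move=> bU; have [W bW WU] := base0_scale (@ltr0Sn _ 1) bU.
by exists W => // v w Wv Ww; apply: (absconvex_half (base0_absconvex bU)); exact: WU.
Qed.

Let lc_filter (x : E) : ProperFilter (nbhs x).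
Proof.
rewrite lc_nbhsE; apply: filter_from_proper.
  apply: filter_from_filter => [|U V bU bV]; first exact: base0_neq0.
  have [W bW WUV] := base0_I bU bV; exists W => // y /= Wy.
  by have [] := WUV _ Wy.
by move=> U bU; exists x; rewrite /= subrr; exact: base00.
Qed.

Let lc_singleton (x : E) (A : set E) : nbhs x A -> A x.
Proof. by case=> U bU; apply; rewrite /= subrr; exact: base00. Qed.

Let lc_nbhs_nbhs (x : E) (A : set E) : nbhs x A -> nbhs x (nbhs^~ A).
Proof.
move=> [U bU UA]; have [W bW WU] := lc_double bU.
exists W => // y /= Wy; exists W => // z /= Wz; apply: UA => /=.
by rewrite -(subrKA y); exact: WU.
Qed.

HB.instance Definition _ :=
  Nbhs_isNbhsTopological.Build E lc_filter lc_singleton lc_nbhs_nbhs.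

Let lc_add_continuous : continuous (fun x : E * E => x.1 + x.2).
Proof.
move=> [x y] A /= [U bU UA]; have [W bW WU] := lc_double bU.
exists ([set z | W (z - x)], [set z | W (z - y)]) => /=.
  by split; exists W.
move=> [u v] /= [Wu Wv]; apply: UA => /=.
by rewrite opprD addrACA; exact: WU.
Qed.

Let lc_scale_continuous : continuous (fun z : K^o * E => z.1 *: z.2).
Proof.
move=> [k x] A /= [U bU UA]; have [W bW WU] := lc_double bU.
have M0 : 0 < `|k| + 1 by rewrite ltr_wpDl.
have [W' bW' W'W] := base0_scale M0 bW.
have [r r0 Wr] := base0_absorbing x bW.
exists ([set l : K^o | `|k - l| < r] `&` [set l : K^o | `|k - l| < 1],
        [set z | W' (z - x)]) => /=.
  split; last by exists W'.
  by apply: filterI; [exists r|exists 1] => //= l; rewrite /ball /= => +.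
move=> [l z] /= [[lr l1] W'z]; apply: UA => /=.
have -> : l *: z - k *: x = l *: (z - x) + (l - k) *: x.
  by rewrite scalerBr scalerBl addrA subrK.
apply: WU.
- have -> : l *: (z - x) = (l / (`|k| + 1)) *: ((`|k| + 1) *: (z - x)).
    by rewrite scalerA mulfVK// gt_eqF.
  apply: (absconvexZ (base0_absconvex bW)); last exact: W'W.
  rewrite normrM normfV (gtr0_norm M0) ler_pdivrMr// mul1r.
  by rewrite -[l](subrK k) addrC (le_trans (ler_normD _ _))// lerD2l ltW// distrC.
- have -> : (l - k) *: x = ((l - k) / r) *: (r *: x).
    by rewrite scalerA mulfVK// gt_eqF.
  apply: (absconvexZ (base0_absconvex bW)) => //.
  rewrite normrM normfV (gtr0_norm r0) ler_pdivrMr// mul1r.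
  by rewrite ltW// distrC.
Qed.

Local Open Scope convex_scope.

Let lc_locally_convex : exists2 B : set_system E,
  (forall b, b \in B -> convex_set b) & basis B.
Proof.
exists [set O | open O /\ convex_set O] => [b|]; first by rewrite inE => -[].
split=> [O [] //|x A [U bU UA]].
exists [set y | nbhs y [set z | U (z - x)]]; last first.
  by move=> y /= /lc_singleton /UA.
split; last by exists U.
split.
  by rewrite openE => y /lc_nbhs_nbhs.
move=> y z l; rewrite !inE /= => -[W bW WU] [W' bW' W'U].
have [W2 bW2 W2W] := base0_I bW bW'.
exists W2 => // t /= W2t; have [Wt W't] := W2W _ W2t.
have /WU Uy : W (y + (t - y <| l |> z) - y) by rewrite addrC addKr.
have /W'U Uz : W' (z + (t - y <| l |> z) - z) by rewrite addrC addKr.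
have l1 : `|l%:num| + `|1 - l%:num| <= 1.
  by rewrite !ger0_norm ?subr_ge0//= addrC subrK.
have := base0_absconvex bU l1 Uy Uz; congr U.
exact: conv_translate.
Qed.

HB.instance Definition _ := PreTopologicalLmod_isTvs.Build K E
  lc_add_continuous lc_scale_continuous lc_locally_convex.
HB.instance Definition _ :=
  PreTopologicalNmodule_isTopologicalNmodule.Build E lc_add_continuous.
HB.instance Definition _ :=
  TopologicalNmodule_isTopologicalLmodule.Build K E lc_scale_continuous.
HB.instance Definition _ := Uniform_isTvs.Build K E lc_locally_convex.

HB.end.

(* Stated with neighbourhoods of 0 because the uniformity carried by a
   [tvsType] is only required to be compatible with the topology, not to be
   translation-invariant. *)
Definition cauchy_seq (K : numFieldType) (E : tvsType K) (u : nat -> E) : Prop :=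
  forall U, nbhs (0 : E) U ->
    exists N, forall m n, (N <= m)%N -> (N <= n)%N -> U (u m - u n).

Definition seminorm (K : numFieldType) (E : lmodType K) (p : E -> K) : Prop :=
  [/\ forall x, 0 <= p x, forall x y, p (x + y) <= p x + p y &
      forall k x, p (k *: x) = `|k| * p x].

(* Local convexity is part of [tvsType] (and follows from the second clause);
   by metrizability, completeness is a condition on sequences. *)
Definition frechet_space (K : numFieldType) (E : tvsType K) : Prop :=
  [/\ hausdorff_space E,
      exists p : nat -> E -> K, (forall n, seminorm (p n)) /\
        forall U, nbhs (0 : E) U <->
          exists N (e : K), 0 < e /\
            [set x | forall n, (n <= N)%N -> p n x < e] `<=` U &
      forall u : nat -> E, cauchy_seq u -> exists l : E, u @ \oo --> l].

Section TvsFacts.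
Context (K : numFieldType) (E : tvsType K).

Lemma nbhs0_add (U : set E) : nbhs 0 U ->
  exists2 W, nbhs 0 W & forall v w, W v -> W w -> U (v + w).
Proof.
move=> U0; have := @add_continuous E (0, 0) U; rewrite /= addr0.
move=> /(_ U0)[[A B] [/= A0 B0] AB].
by exists (A `&` B) => [|v w [Av _] [_ Bw]]; [exact: filterI|exact: (AB (v, w))].
Qed.

Lemma nbhs0_scale (k : K) (U : set E) : nbhs 0 U ->
  nbhs 0 [set v | U (k *: v)].
Proof.
move=> U0; have := @scale_continuous K E (k, 0) U; rewrite /= scaler0.
move=> /(_ U0)[[A B] [/= A0 B0] AB]; apply: filterS B0 => v Bv.
by apply: (AB (k, v)); split => //; exact: nbhs_singleton.
Qed.

Lemma nbhs0_absorbing (U : set E) v : nbhs 0 U ->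
  exists2 r : K, 0 < r & U (r *: v).
Proof.
move=> U0; have := @scale_continuous K E (0, v) U; rewrite /= scale0r.
move=> /(_ U0)[[A B] [/= [e /= e0 eA] B0] AB].
exists (e / 2); first by rewrite divr_gt0.
apply: (AB (e / 2, v)); split => /=; last exact: nbhs_singleton.
by apply: eA; rewrite /= sub0r normrN gtr0_norm ?divr_gt0// gtr_pMr// invf_lt1 ?ltr1n.
Qed.

Lemma nbhs_translate (x : E) (A : set E) :
  nbhs x A <-> nbhs 0 [set v | A (x + v)].
Proof.
split=> [xA|A0].
  have := @add_continuous E (x, 0) A; rewrite /= addr0.
  move=> /(_ xA)[[B C] [/= B0 C0] BC]; apply: filterS C0 => v Cv.
  by apply: (BC (x, v)); split => //; exact: nbhs_singleton.
have := @add_continuous E (x, - x) [set v | A (x + v)]; rewrite /= subrr.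
move=> /(_ A0)[[B C] [/= B0 C0] BC]; apply: filterS B0 => v Bv.
have /= := BC (v, - x); rewrite [v - x]addrC addNKr; apply.
by split => //; exact: nbhs_singleton.
Qed.

Lemma closure_submodule (W : set E) : submodule W -> submodule (closure W).
Proof.
move=> [W0 WD WZ]; split=> [|v w Wv Ww A|k v Wv A].
- exact: subset_closure.
- move=> /nbhs_translate /nbhs0_add[B B0 BA].
  have [v' [Wv' Bv']] : W `&` [set t | B (t - v)] !=set0.
    by apply/Wv/nbhs_translate; apply: filterS B0 => t /=; rewrite addrC addKr.
  have [w' [Ww' Bw']] : W `&` [set t | B (t - w)] !=set0.
    by apply/Ww/nbhs_translate; apply: filterS B0 => t /=; rewrite addrC addKr.
  exists (v' + w'); split; first exact: WD.
  have /= := BA _ _ Bv' Bw'.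
  by rewrite [X in A (_ + X)]addrACA -opprD [v + w + _]addrC subrK.
- move=> /nbhs_translate /(nbhs0_scale k) B0.
  have [v' [Wv' Bv']] : W `&` [set t | A (k *: v + k *: (t - v))] !=set0.
    by apply/Wv/nbhs_translate; apply: filterS B0 => t /=; rewrite [v + t]addrC addrK.
  exists (k *: v'); split; first exact: WZ.
  by move: Bv'; rewrite /= -scalerDr addrC subrK.
Qed.

End TvsFacts.

Lemma banach_frechet (K : numFieldType) (E : completeNormedModType K) :
  frechet_space E.
Proof.
split; first exact: norm_hausdorff.
- exists (fun=> fun x : E => `|x|); split=> [n|U].
    by split=> [//|x y|k x]; [exact: ler_normD|exact: normrZ].
  split=> [/nbhs_ballP[e /= e0 eU]|[N [e [e0 eU]]]].
    exists 0%N, e; split=> // x /(_ 0%N isT) xe; apply: eU.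
    by rewrite -ball_normE /= sub0r normrN.
  apply/nbhs_ballP; exists e => //= x.
  by rewrite -ball_normE /= sub0r normrN => xe; apply: eU => n _.
- move=> u uc; apply/cvg_ex; apply: cauchy_cvg; apply/cauchy_ballP => e e0.
  have [|N HN] := uc (ball (0 : E) e); first exact: nbhsx_ballx.
  exists ([set x | exists2 n, (N <= n)%N & x = u n],
          [set x | exists2 n, (N <= n)%N & x = u n]) => /=.
    by split; exists N => // n /= Nn; exists n.
  move=> [x y] /= [[m Nm ->] [n Nn ->]].
  by have := HN _ _ Nm Nn; rewrite -!ball_normE /= sub0r normrN.
Qed.

Section LinearContinuous.
Context (K : numFieldType) (E F : tvsType K) (h : {linear E -> F}).

Lemma linear_continuous0 :
  (forall U, nbhs 0 U -> nbhs 0 (h @^-1` U)) -> continuous h.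
Proof.
move=> h0 x A /nbhs_translate /h0 A0; apply/nbhs_translate.
by apply: filterS A0 => v /=; rewrite linearD.
Qed.

Lemma continuous_nbhs0 (U : set F) : continuous h -> nbhs 0 U ->
  nbhs 0 (h @^-1` U).
Proof. by move=> hc U0; apply: hc; rewrite linear0. Qed.

Lemma closure_lspan_map (S : set E) (T : set F) : continuous h ->
  (forall v, S v -> T (h v)) ->
  forall v, closure (lspan S) v -> closure (lspan T) (h v).
Proof.
move=> hc hST v Sv A /hc/Sv[w [Sw Aw]]; exists (h w); split => //.
apply: (Sw [set u | lspan T (h u)]) => [|u /hST]; last exact: sub_lspan.
have [T0 TD TZ] := lspan_submodule T.
split=> /= [|u t Tu Tt|k u Tu]; first by rewrite linear0.
- by rewrite linearD; exact: TD.
- by rewrite linearZ; exact: TZ.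
Qed.

End LinearContinuous.

(* The algebraic tensor product: the free vector space on Y x X modulo the
   bilinearity relations. *)

Section Tensor.
Context (K : numFieldType) (Y X : tvsType K).

Inductive tensor_rel : set {freeg (Y * X)%type / K} :=
| tensor_relDl y1 y2 x :
    tensor_rel (<< (y1 + y2, x) >> - << (y1, x) >> - << (y2, x) >>)
| tensor_relDr y x1 x2 :
    tensor_rel (<< (y, x1 + x2) >> - << (y, x1) >> - << (y, x2) >>)
| tensor_relZl k y x :
    tensor_rel (<< (k *: y, x) >> - k *: << (y, x) >>)
| tensor_relZr k y x :
    tensor_rel (<< (y, k *: x) >> - k *: << (y, x) >>).

Definition tensor : Type := lquot tensor_rel.

HB.instance Definition _ := GRing.Lmodule.on tensor.

Definition tens (y : Y) (x : X) : tensor := lproj tensor_rel << (y, x) >>.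

Lemma tensDl y1 y2 x : tens (y1 + y2) x = tens y1 x + tens y2 x.
Proof.
rewrite /tens -lprojD; apply/lprojP; rewrite opprD addrA.
by apply: sub_lspan; exact: tensor_relDl.
Qed.

Lemma tensDr y x1 x2 : tens y (x1 + x2) = tens y x1 + tens y x2.
Proof.
rewrite /tens -lprojD; apply/lprojP; rewrite opprD addrA.
by apply: sub_lspan; exact: tensor_relDr.
Qed.

Lemma tensZl k y x : tens (k *: y) x = k *: tens y x.
Proof.
by rewrite /tens -linearZ; apply/lprojP; apply: sub_lspan; exact: tensor_relZl.
Qed.

Lemma tensZr k y x : tens y (k *: x) = k *: tens y x.
Proof.
by rewrite /tens -linearZ; apply/lprojP; apply: sub_lspan; exact: tensor_relZr.
Qed.

Lemma tensor_ind (P : tensor -> Prop) : P 0 ->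
  (forall k y x t, P t -> P (k *: tens y x + t)) -> forall t, P t.
Proof.
move=> P0 PS t; rewrite -(lreprK t); elim/freeg_ind_dom0: (lrepr t).
  by rewrite linear0.
move=> k [y x] D _ _ PD; rewrite linearD.
suff -> : << k *g (y, x) >> = k *: << (y, x) >> by rewrite linearZ; exact: PS.
by apply/eqP/freeg_eqP => z; rewrite coeffZ !coeffU mul1r.
Qed.

(* The projective topology: a base at 0 consists of the absolutely convex
   hulls of the sets U (x) V, with U and V neighbourhoods of 0. *)
Definition proj_base0 : set_system tensor :=
  [set W | exists U V, [/\ nbhs (0 : Y) U, nbhs (0 : X) V &
    W = absconvex_hull [set tens y x | y in U & x in V]]].

Lemma proj_base0_neq0 : exists U, proj_base0 U.
Proof.
by eexists; exists setT, setT; split; [exact: filterT|exact: filterT|].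
Qed.

Lemma proj_base0_I U V : proj_base0 U -> proj_base0 V ->
  exists2 W, proj_base0 W & W `<=` U `&` V.
Proof.
move=> [A [B [A0 B0 ->]]] [A' [B' [A'0 B'0 ->]]].
eexists; first by exists (A `&` A'), (B `&` B'); split; [exact: filterI|exact: filterI|].
move=> t Wt; split.
- move: t Wt; apply: absconvex_hull_sub; first exact: absconvex_hull_absconvex.
  by move=> _ [y [Ay _]] [x [Bx _] <-]; apply: sub_absconvex_hull; exists y => //; exists x.
- move: t Wt; apply: absconvex_hull_sub; first exact: absconvex_hull_absconvex.
  by move=> _ [y [_ Ay]] [x [_ Bx] <-]; apply: sub_absconvex_hull; exists y => //; exists x.
Qed.

Lemma proj_base0_scale (r : K) U : 0 < r -> proj_base0 U ->
  exists2 W, proj_base0 W & forall w, W w -> U (r *: w).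
Proof.
move=> r0 [A [B [A0 B0 ->]]].
eexists; first by exists [set y | A (r *: y)], B; split; [exact: nbhs0_scale|exact: B0|].
apply: absconvex_hull_sub => [|_ [y Ay] [x Bx <-]].
  by apply: absconvex_preimageZ; exact: absconvex_hull_absconvex.
by rewrite /= -tensZl; apply: sub_absconvex_hull; exists (r *: y) => //; exists x.
Qed.

Lemma proj_base0_absconvex U : proj_base0 U -> absconvex U.
Proof. by move=> [A [B [_ _ ->]]]; exact: absconvex_hull_absconvex. Qed.

Lemma proj_base0_absorbing U t : proj_base0 U ->
  exists2 r : K, 0 < r & U (r *: t).
Proof.
move=> bU; have aU := proj_base0_absconvex bU.
case: bU aU => [A [B [A0 B0 ->]]]; set W := absconvex_hull _ => aW.
have Wtens y x : exists2 r : K, 0 < r & W (r *: tens y x).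
  have [r r0 Ar] := nbhs0_absorbing y A0; have [s s0 Bs] := nbhs0_absorbing x B0.
  exists (r * s); first exact: mulr_gt0.
  by rewrite -scalerA -tensZr -tensZl; apply: sub_absconvex_hull; exists (r *: y) => //; exists (s *: x).
elim/tensor_ind: t => [|k y x t [s s0 Wt]].
  exists 1 => //; rewrite scaler0; have [r _ Wr] := Wtens 0 0.
  exact: (absconvex0 aW Wr).
have [r r0 Wyx] := Wtens y x.
pose c := r * s / (r + s * `|k|).
have d0 : 0 < r + s * `|k| by rewrite ltr_wpDr// mulr_ge0// ltW.
exists c; first by rewrite divr_gt0// mulr_gt0.
have ck : c * k = (s * k / (r + s * `|k|)) * r by rewrite /c; field; rewrite gt_eqF.
have cs : c = (r / (r + s * `|k|)) * s by rewrite /c; field; rewrite gt_eqF.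
rewrite scalerDr scalerA ck -(scalerA _ r) cs -(scalerA _ s).
apply: aW => //.
rewrite !normrM !normfV (gtr0_norm d0) (gtr0_norm r0) (gtr0_norm s0).
by rewrite -mulrDl [s * _ + r]addrC divff// gt_eqF.
Qed.

HB.instance Definition _ := Lmodule_isLocallyConvex.Build K tensor
  proj_base0_neq0 proj_base0_I proj_base0_scale
  proj_base0_absconvex proj_base0_absorbing.

Lemma nbhs0_tensor (A : set tensor) :
  nbhs 0 A <-> exists2 U, proj_base0 U & U `<=` A.
Proof.
split=> [[U bU UA]|[U bU UA]]; exists U => // t /=.
  by move=> Ut; apply: UA; rewrite /= subr0.
by rewrite subr0; exact: UA.
Qed.

End Tensor.

Section TensorMap.
Context (K : numFieldType) (Y1 Y2 X : tvsType K) (f : {linear Y1 -> Y2}).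

Definition free_map (D : {freeg (Y1 * X)%type / K}) :
    {freeg (Y2 * X)%type / K} :=
  fglift (fun p => << (f p.1, p.2) >>) D.

Lemma free_map_is_linear : linear free_map.
Proof.
have addM : zmod_morphism free_map by exact: lift_is_additive.
have M0 : free_map 0 = 0 by have := addM 0 0; rewrite !subrr.
have MD : forall a b, free_map (a + b) = free_map a + free_map b.
  by move=> a b; rewrite -{1}[b]opprK addM -[- b]sub0r addM M0 sub0r opprK.
move=> k D E; rewrite MD; congr +%R.
elim/freeg_ind_dom0: D => [|c z D _ _ IH]; first by rewrite scaler0 M0 scaler0.
rewrite scalerDr !MD scalerDr IH; congr +%R.
have -> : k *: << c *g z >> = << (k * c) *g z >>.
  by apply/eqP/freeg_eqP => t; rewrite coeffZ !coeffU mulrA.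
by rewrite /free_map !liftU scalerA.
Qed.

HB.instance Definition _ := GRing.isLinear.Build K _ _ *:%R free_map
  free_map_is_linear.

Lemma free_mapE y x : free_map << (y, x) >> = << (f y, x) >>.
Proof. by rewrite /free_map liftU scale1r. Qed.

Lemma free_map_rel D : tensor_rel D -> lspan (@tensor_rel K Y2 X) (free_map D).
Proof.
case=> [y1 y2 x|y x1 x2|k y x|k y x]; apply: sub_lspan.
- by rewrite !linearB/= !free_mapE linearD; exact: tensor_relDl.
- by rewrite !linearB/= !free_mapE; exact: tensor_relDr.
- by rewrite linearB linearZ/= !free_mapE linearZ; exact: tensor_relZl.
- by rewrite linearB linearZ/= !free_mapE; exact: tensor_relZr.
Qed.

Definition tensor_map : tensor Y1 X -> tensor Y2 X :=
  lquot_map (@tensor_rel K Y2 X) free_map.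

Lemma tensor_map_is_linear : linear tensor_map.
Proof. exact: (lquot_map_is_linear free_map_rel). Qed.

HB.instance Definition _ := GRing.isLinear.Build K _ _ *:%R tensor_map
  tensor_map_is_linear.

Lemma tensor_mapE y x : tensor_map (tens y x) = tens (f y) x.
Proof. by rewrite /tensor_map (lquot_mapE free_map_rel) /= free_mapE. Qed.

Lemma tensor_map_continuous : continuous f -> continuous tensor_map.
Proof.
move=> fc; apply: (@linear_continuous0 K (tensor Y1 X) (tensor Y2 X) tensor_map).
move=> A /nbhs0_tensor[_ [U [V [U0 V0 ->]]] UVA].
apply/nbhs0_tensor; eexists.
  by exists (f @^-1` U), V; split; [exact: continuous_nbhs0|exact: V0|].
apply: (subset_trans (B := tensor_map @^-1`
  (absconvex_hull [set tens y x | y in U & x in V]))); last first.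
  by move=> t; exact: UVA.
apply: absconvex_hull_sub => [|_ [y Uy] [x Vx <-]].
  by apply: absconvex_preimage; exact: absconvex_hull_absconvex.
by rewrite /= tensor_mapE; apply: sub_absconvex_hull; exists (f y) => //; exists x.
Qed.

End TensorMap.

(* The Hausdorff completion as the space of Cauchy sequences modulo null
   sequences. Sequences suffice for spaces with a countable base at 0, such as
   the projective tensor product of two metrizable spaces. *)

Section CauchySequences.
Context (K : numFieldType) (E : tvsType K).

Definition cauchy_pred : {pred (nat -> E)} := fun u => `[< cauchy_seq u >].

Lemma cauchy_pred_closed : submod_closed cauchy_pred.
Proof.
split=> [|k u v /asboolP uc /asboolP vc]; apply/asboolP => U U0.
  by exists 0%N => m n _ _; rewrite subrr; exact: nbhs_singleton.
have [W W0 WU] := nbhs0_add U0.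
have [N1 HN1] := uc _ (nbhs0_scale k W0); have [N2 HN2] := vc _ W0.
exists (maxn N1 N2) => m n; rewrite !geq_max => /andP[m1 m2] /andP[n1 n2].
have /= := WU _ _ (HN1 _ _ m1 n1) (HN2 _ _ m2 n2); congr U.
by rewrite !fctE scalerBr opprD addrACA.
Qed.

HB.instance Definition _ :=
  GRing.isSubmodClosed.Build K (nat -> E) cauchy_pred cauchy_pred_closed.

Record cseq := CSeq { cseq_val :> nat -> E; _ : cauchy_pred cseq_val }.

HB.instance Definition _ := [isSub for cseq_val].
HB.instance Definition _ := [Choice of cseq by <:].
HB.instance Definition _ := [SubChoice_isSubLmodule of cseq by <:].

Lemma cseqP (u : cseq) : cauchy_seq u.
Proof. by case: u => u /= /asboolP. Qed.

Definition mk_cseq (u : nat -> E) (uc : cauchy_seq u) : cseq :=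
  CSeq (asboolT uc).

Lemma cauchy_cst (x : E) : cauchy_seq (fun=> x).
Proof.
by move=> U U0; exists 0%N => m n _ _; rewrite subrr; exact: nbhs_singleton.
Qed.

Definition null_seq : set cseq := [set u : cseq | (u : nat -> E) @ \oo --> (0 : E)].

Lemma null_seqP (u : cseq) : null_seq u <->
  forall U, nbhs (0 : E) U -> exists N, forall n, (N <= n)%N -> U (u n).
Proof.
split=> [u0 U /u0[N _ NU]|u0 U /u0[N NU]].
  by exists N => n Nn; exact: (NU n Nn).
by exists N => // n /= Nn; exact: NU.
Qed.

Lemma null_seq_submodule : submodule null_seq.
Proof.
split=> [|u v /null_seqP u0 /null_seqP v0|k u /null_seqP u0]; apply/null_seqP => U U0.
- by exists 0%N => n _; exact: nbhs_singleton.
- have [W W0 WU] := nbhs0_add U0.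
  have [N1 HN1] := u0 _ W0; have [N2 HN2] := v0 _ W0.
  exists (maxn N1 N2) => n; rewrite geq_max => /andP[n1 n2].
  exact: (WU _ _ (HN1 _ n1) (HN2 _ n2)).
- by have [N HN] := u0 _ (nbhs0_scale k U0); exists N => n /HN.
Qed.

Definition completion : Type := lquot null_seq.

HB.instance Definition _ := GRing.Lmodule.on completion.

Definition to_completion (x : E) : completion :=
  lproj null_seq (mk_cseq (cauchy_cst x)).

(* A base at 0: the closures of the absolutely convex neighbourhoods of 0. *)
Definition compl_set (U : set E) : set completion :=
  [set z | exists u : cseq, z = lproj null_seq u /\
    exists N, forall n, (N <= n)%N -> U (u n)].

Definition compl_base0 : set_system completion :=
  [set W | exists U, [/\ absconvex U, nbhs (0 : E) U & W = compl_set U]].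

Lemma compl_base0_neq0 : exists U, compl_base0 U.
Proof. by eexists; exists setT; split=> //; exact: filterT. Qed.

Lemma compl_base0_I U V : compl_base0 U -> compl_base0 V ->
  exists2 W, compl_base0 W & W `<=` U `&` V.
Proof.
move=> [A [aA A0 ->]] [B [aB B0 ->]].
exists (compl_set (A `&` B)).
  exists (A `&` B); split=> //; last exact: filterI.
  by move=> a b v w ab [Av Bv] [Aw Bw]; split; [exact: aA|exact: aB].
by move=> z [u [-> [N NAB]]]; split; exists u; split=> //; exists N => n /NAB[].
Qed.

Lemma compl_base0_scale (r : K) U : 0 < r -> compl_base0 U ->
  exists2 W, compl_base0 W & forall w, W w -> U (r *: w).
Proof.
move=> r0 [A [aA A0 ->]]; exists (compl_set [set v | A (r *: v)]).
  exists [set v | A (r *: v)]; split=> //; first exact: absconvex_preimageZ.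
  exact: nbhs0_scale.
move=> z [u [-> [N NA]]]; exists (r *: u); split; first by rewrite linearZ.
by exists N => n /NA.
Qed.

Lemma compl_base0_absconvex U : compl_base0 U -> absconvex U.
Proof.
move=> [A [aA A0 ->]] a b _ _ ab [u [-> [N NA]]] [v [-> [M MA]]].
exists (a *: u + b *: v); split; first by rewrite linearD !linearZ.
exists (maxn N M) => n; rewrite geq_max => /andP[/NA Au /MA Av].
exact: aA.
Qed.

Lemma compl_base0_absorbing U z : compl_base0 U ->
  exists2 r : K, 0 < r & U (r *: z).
Proof.
move=> [A [aA A0 ->]]; rewrite -(lreprK z); set u := lrepr z.
have [N NA] := cseqP u A0; have [r r0 Ar] := nbhs0_absorbing (u N) A0.
have d0 : 0 < 1 + r by rewrite addr_gt0.
exists (r / (1 + r)); first by rewrite divr_gt0.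
exists ((r / (1 + r)) *: u); split; first by rewrite linearZ.
exists N => n Nn.
have -> : ((r / (1 + r)) *: u) n =
    (r / (1 + r)) *: (u n - u N) + (1 + r)^-1 *: (r *: u N).
  by rewrite scalerA scalerBr [_^-1 * r]mulrC subrK.
apply: aA => //; last exact: NA.
rewrite normrM normfV (gtr0_norm d0) (gtr0_norm r0).
by rewrite -[X in _ + X]mul1r -mulrDl [r + 1]addrC divff// gt_eqF.
Qed.

HB.instance Definition _ := Lmodule_isLocallyConvex.Build K completion
  compl_base0_neq0 compl_base0_I compl_base0_scale
  compl_base0_absconvex compl_base0_absorbing.

Lemma nbhs0_completion (A : set completion) :
  nbhs 0 A <-> exists2 U, compl_base0 U & U `<=` A.
Proof.
split=> [[U bU UA]|[U bU UA]]; exists U => // t /=.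
  by move=> Ut; apply: UA; rewrite /= subr0.
by rewrite subr0; exact: UA.
Qed.

End CauchySequences.

Section CompletionMap.
Context (K : numFieldType) (E F : tvsType K) (h : {linear E -> F}).
Context (hc : continuous h).

Lemma cauchy_comp (u : cseq E) : cauchy_seq (h \o u).
Proof.
move=> U /(continuous_nbhs0 hc)/(cseqP u)[N NU]; exists N => m n Nm Nn /=.
by rewrite -linearB; exact: NU.
Qed.

Definition cseq_map (u : cseq E) : cseq F := mk_cseq (cauchy_comp u).

Lemma cseq_map_is_linear : linear cseq_map.
Proof. by move=> k u v; apply: val_inj; apply/funext => n /=; rewrite linearP. Qed.

HB.instance Definition _ := GRing.isLinear.Build K _ _ *:%R cseq_map
  cseq_map_is_linear.

Lemma cseq_map_null u : null_seq u -> lspan (@null_seq K F) (cseq_map u).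
Proof.
move=> u0; apply: sub_lspan; apply/null_seqP => U /(continuous_nbhs0 hc).
by move: u0 => /null_seqP /[apply].
Qed.

Definition completion_map : completion E -> completion F :=
  lquot_map (@null_seq K F) cseq_map.

Lemma completion_map_is_linear : linear completion_map.
Proof. exact: (lquot_map_is_linear cseq_map_null). Qed.

HB.instance Definition _ := GRing.isLinear.Build K _ _ *:%R completion_map
  completion_map_is_linear.

Lemma completion_mapE x :
  completion_map (to_completion x) = to_completion (h x).
Proof.
rewrite /completion_map /to_completion (lquot_mapE cseq_map_null).
by congr lproj; apply: val_inj.
Qed.

Lemma completion_map_continuous : continuous completion_map.
Proof.
apply: linear_continuous0 => A /nbhs0_completion[_ [U [aU U0 ->]] UA].
apply/nbhs0_completion; exists (compl_set (h @^-1` U)).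
  exists (h @^-1` U); split=> //; first exact: absconvex_preimage.
  exact: continuous_nbhs0.
move=> _ [u [-> [N NU]]]; apply: UA; exists (cseq_map u); split.
  exact: (lquot_mapE cseq_map_null).
by exists N => n /NU.
Qed.

End CompletionMap.

(* Banach algebras and modules; neither the algebras nor the modules are
   assumed unital. *)

HB.mixin Record isBanachAlgebra (K : numFieldType) A
    & CompleteNormedModule K A := {
  bmul : A -> A -> A;
  bmulA : forall a b c, bmul a (bmul b c) = bmul (bmul a b) c;
  bmulDl : forall a b c, bmul (a + b) c = bmul a c + bmul b c;
  bmulDr : forall a b c, bmul a (b + c) = bmul a b + bmul a c;
  bmulZl : forall k a b, bmul (k *: a) b = k *: bmul a b;
  bmulZr : forall k a b, bmul a (k *: b) = k *: bmul a b;
  bmul_norm : forall a b, `|bmul a b| <= `|a| * `|b|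
}.

#[short(type="banachAlgType")]
HB.structure Definition BanachAlgebra (K : numFieldType) :=
  {A of CompleteNormedModule K A & isBanachAlgebra K A}.

HB.mixin Record isRightModule (K : numFieldType) (A : banachAlgType K) Y
    & Tvs K Y := {
  ract : Y -> A -> Y;
  ractA : forall y a b, ract (ract y a) b = ract y (bmul a b);
  ractDl : forall y z a, ract (y + z) a = ract y a + ract z a;
  ractDr : forall y a b, ract y (a + b) = ract y a + ract y b;
  ractZl : forall k y a, ract (k *: y) a = k *: ract y a;
  ractZr : forall k y a, ract y (k *: a) = k *: ract y a;
  ract_continuous : continuous (fun p : Y * A => ract p.1 p.2)
}.

HB.mixin Record isLeftModule (K : numFieldType) (A : banachAlgType K) X
    & Tvs K X := {
  lact : A -> X -> X;
  lactA : forall a b x, lact a (lact b x) = lact (bmul a b) x;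
  lactDl : forall a b x, lact (a + b) x = lact a x + lact b x;
  lactDr : forall a x y, lact a (x + y) = lact a x + lact a y;
  lactZl : forall k a x, lact (k *: a) x = k *: lact a x;
  lactZr : forall k a x, lact a (k *: x) = k *: lact a x;
  lact_continuous : continuous (fun p : A * X => lact p.1 p.2)
}.

#[short(type="tvsRModType")]
HB.structure Definition TvsRightModule (K : numFieldType) (A : banachAlgType K) :=
  {Y of Tvs K Y & isRightModule K A Y}.

#[short(type="banachRModType")]
HB.structure Definition BanachRightModule (K : numFieldType)
    (A : banachAlgType K) :=
  {Y of CompleteNormedModule K Y & isRightModule K A Y}.

#[short(type="tvsLModType")]
HB.structure Definition TvsLeftModule (K : numFieldType) (A : banachAlgType K) :=
  {X of Tvs K X & isLeftModule K A X}.

#[short(type="banachLModType")]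
HB.structure Definition BanachLeftModule (K : numFieldType)
    (A : banachAlgType K) :=
  {X of CompleteNormedModule K X & isLeftModule K A X}.

Record cmodmap (K : numFieldType) (A : banachAlgType K)
    (Y Z : tvsRModType A) := CModMap {
  cmodmap_val :> {linear Y -> Z};
  cmodmap_continuous : continuous cmodmap_val;
  cmodmap_act : forall y a, cmodmap_val (ract y a) = ract (cmodmap_val y) a
}.

Arguments cmodmap_continuous {K A Y Z} c x t _.

Definition short_exact (U V W : zmodType) (f : U -> V) (g : V -> W) : Prop :=
  [/\ injective f, range f = g @^-1` [set 0] & range g = setT].

Definition cptensor (K : numFieldType) (Y X : tvsType K) : tvsType K :=
  completion (tensor Y X).

Definition ctens (K : numFieldType) (Y X : tvsType K) (y : Y) (x : X) :
    cptensor Y X :=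
  to_completion (tens y x).

Section BalancedTensor.
Context (K : numFieldType) (A : banachAlgType K).
Context (Y : tvsRModType A) (X : tvsLModType A).

Definition balanced_rel : set (cptensor Y X) :=
  [set z | exists y a x, z = ctens (ract y a) x - ctens y (lact a x)].

Definition balanced_null : set (cptensor Y X) := closure (lspan balanced_rel).

Lemma balanced_null_submodule : submodule balanced_null.
Proof. by apply: closure_submodule; exact: lspan_submodule. Qed.

(* By [balanced_null_submodule] and [lspan_id] this is the quotient by
   balanced_null itself, the closed linear span of balanced_rel. *)
Definition btensor : Type := lquot balanced_null.

HB.instance Definition _ := GRing.Lmodule.on btensor.

Definition btens (y : Y) (x : X) : btensor := lproj balanced_null (ctens y x).

End BalancedTensor.

Section BalancedTensorMap.
Context (K : numFieldType) (A : banachAlgType K).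
Context (Y Z : tvsRModType A) (X : tvsLModType A) (f : cmodmap Y Z).

Definition cptensor_map : cptensor Y X -> cptensor Z X :=
  completion_map (tensor_map_continuous (cmodmap_continuous f)).

HB.instance Definition _ := GRing.Linear.on cptensor_map.

Lemma cptensor_mapE y x : cptensor_map (ctens y x) = ctens (f y) x.
Proof. by rewrite /cptensor_map completion_mapE /= tensor_mapE. Qed.

Lemma balanced_null_map z : balanced_null z ->
  lspan (@balanced_null _ _ Z X) (cptensor_map z).
Proof.
move=> zN; apply: sub_lspan; apply: closure_lspan_map zN.
  exact: completion_map_continuous.
move=> _ [y [a [x ->]]]; rewrite linearB/= !cptensor_mapE cmodmap_act.
by exists (f y), a, x.
Qed.

Definition btensor_map : btensor Y X -> btensor Z X :=
  lquot_map (@balanced_null _ _ Z X) cptensor_map.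

Lemma btensor_map_is_linear : linear btensor_map.
Proof. exact: (lquot_map_is_linear balanced_null_map). Qed.

HB.instance Definition _ := GRing.isLinear.Build K _ _ *:%R btensor_map
  btensor_map_is_linear.

Lemma btensor_mapE y x : btensor_map (btens y x) = btens (f y) x.
Proof. by rewrite /btensor_map (lquot_mapE balanced_null_map) /= cptensor_mapE. Qed.

End BalancedTensorMap.

Arguments btensor_map {K A Y Z} X f _.

(* Main.v *)
(* Right exactness of the tensor product holds in general, so exactness amounts
   to [f (x) 1 : Y1 (x)_A X -> Y2 (x)_A X] being a topological embedding (modulo
   the balancing relations). For Banach modules this follows from (ii) by the
   open mapping theorem. For Frechet modules, the topology of Y2 is generated by
   seminorms q with q(ya) <= q(y)|a|. The completions of Y1, Y2 and Y2/Y1 in the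
   seminorms induced by q are Banach modules and form a short exact sequence, so
   [f (x) 1] is an embedding for each q, hence for the Frechet topologies. *)
Require Import Defs.
From HB Require Import structures.
From mathcomp Require Import all_boot all_order all_algebra.
From mathcomp Require Import complex.
From mathcomp Require Import boolp classical_sets functions reals.
From mathcomp Require Import topology normedtype.
From mathcomp Require Import freeg lra.

Set Implicit Arguments.
Unset Strict Implicit.
Unset Printing Implicit Defensive.

Import Order.TTheory GRing.Theory Num.Theory.
Import numFieldNormedType.Exports.

Local Open Scope classical_set_scope.
Local Open Scope ring_scope.

(** * Successive approximation *)

(* [ring] needs a ring: this decides identities in an abelian group. *)
Ltac cancel_in e x :=
  lazymatch x with
  | (- ?z)%R =>
    lazymatch e with
    | (?e1 + z)%R => rewrite (addrK z e1)
    | (?e1 + ?y)%R => rewrite (addrAC e1 y x); cancel_in e1 x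
    | z => rewrite (subrr z)
    end
  | ?z =>
    lazymatch e with
    | (?e1 + - z)%R => rewrite (subrK z e1)
    | (?e1 + ?y)%R => rewrite (addrAC e1 y x); cancel_in e1 x
    | (- z)%R => rewrite (addNr z)
    end
  end.

Ltac abel :=
  apply/eqP; rewrite -subr_eq0 ?(opprD, opprK, addrA, oppr0, addr0, add0r);
  repeat (lazymatch goal with |- is_true ((?e + ?x)%R == 0) => cancel_in e x end;
          rewrite ?(addr0, add0r));
  by rewrite eqxx.

(** No topology is ever put on [Y (x)_A X]: neighbourhoods of 0 there are replaced by sets [N + W],
    where [N] consists of the balancing relations. Two models are used side by side. Completed
    tensor products admit the open mapping theorem and infinite sums; algebraic ones have elements
    that are finite sums and can be lifted along [g] or mapped by a universal property. Density
    translates statements between the two. Completing the algebraic exact sequence gives the kernel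
    of [g (x) 1] only as a closure. Here the embedding property is used once more: it bounds the
    preimages of small kernel elements, so that successive approximation reaches the kernel exactly.
    The other obstacle is the return from Banach modules. Condition (ii) controls tensors over the
    completion of Y1, whereas the claim is about Y1; so the map from [Y1 (x)_A X] to the tensor
    product over the completion must be shown to reflect smallness. The seminorm on Y1 has to be the
    restriction of one on Y2, since this makes the completed map isometric; such seminorms suffice
    because [f] is an embedding by the open mapping theorem. *)

Section CountableBase.
Context (K : numFieldType) (E : tvsType K).

Definition countable_base : Prop :=
  exists U : nat -> set E, (forall k, nbhs (0 : E) (U k)) /\
    forall A, nbhs (0 : E) A -> exists k, U k `<=` A.

Definition seq_complete : Prop :=
  forall u : nat -> E, cauchy_seq u -> exists l : E, u @ \oo --> l.

(** The [U k] imitate balls of radius 2^-k; the second clause is the halving of the radius. *)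
Definition nested (U : nat -> set E) : Prop :=
  [/\ forall k, nbhs (0 : E) (U k),
      forall k v w, U k.+1 v -> U k.+1 w -> U k (v + w) &
      forall k v, U k v -> U k (- v)].

(** This is [N + W]. For a submodule [N] it is the preimage in [E] of the image of [W] in [E / N],
    which replaces the quotient topology. *)
Definition thicken (W N : set E) : set E := [set z | exists2 n, N n & W (z - n)].

Lemma nbhs0_half (U : set E) : nbhs 0 U ->
  exists W, [/\ nbhs 0 W, forall v w, W v -> W w -> U (v + w) &
    forall v, W v -> W (- v)].
Proof.
move=> /nbhs0_add[W W0 WU]; exists (W `&` [set v | W (- v)]); split.
- apply: filterI => //; apply: filterS (nbhs0_scale (-1) W0) => v /=.
  by rewrite scaleN1r.
- by move=> v w [Wv _] [Ww _]; exact: WU.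
- by move=> v [Wv WNv]; split=> //=; rewrite opprK.
Qed.

Lemma nbhs0_sub (U : set E) : nbhs 0 U ->
  exists2 W, nbhs 0 W & forall v w, W v -> W w -> U (v - w).
Proof.
move=> /nbhs0_half[W [W0 WD WN]]; exists W => // v w Wv /WN.
exact: WD.
Qed.

Lemma half_sub (U W : set E) : nbhs 0 W ->
  (forall v w, W v -> W w -> U (v + w)) -> W `<=` U.
Proof.
by move=> W0 WU v Wv; rewrite -[v]addr0; apply: WU => //; exact: nbhs_singleton.
Qed.

Lemma cvg_nbhs0 (u : nat -> E) (l : E) : u @ \oo --> l <->
  forall U, nbhs (0 : E) U -> exists N, forall n, (N <= n)%N -> U (u n - l).
Proof.
split=> [ul U U0|ul A /nbhs_translate /ul[N NA]].
  have /ul[N _ NU] : nbhs l [set v | U (v - l)].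
    by apply/nbhs_translate; apply: filterS U0 => v /=; rewrite addrC addKr.
  by exists N => n Nn; exact: (NU n Nn).
by exists N => // n /= /NA /=; rewrite addrC subrK.
Qed.

Lemma exists_nested (B : nat -> set E) : (forall k, nbhs (0 : E) (B k)) ->
  exists2 U, nested U & forall k, U k `<=` B k.
Proof.
move=> B0.
have /choice[half halfP] (U : set E) : exists W, nbhs 0 U ->
    [/\ nbhs 0 W, forall v w, W v -> W w -> U (v + w) &
    forall v, W v -> W (- v)].
  have [/nbhs0_half[W WP]|nU] := pselect (nbhs 0 U); first by exists W.
  by exists set0 => /nU.
pose V := fix V k := if k is k'.+1 then half (V k' `&` B k) else half (B 0%N).
have V0 k : nbhs 0 (V k).
  elim: k => [|k IH] /=; first by have [] := halfP _ (B0 0%N).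
  by have [] := halfP _ (filterI IH (B0 k.+1)).
exists V; first split=> //.
- move=> k v w /= Vv Vw; have [_ /(_ v w Vv Vw)[//]] := halfP _ (filterI (V0 k) (B0 k.+1)).
- case=> [|k] v /=; first by have [_ _] := halfP _ (B0 0%N); exact.
  by have [_ _] := halfP _ (filterI (V0 k) (B0 k.+1)); exact.
- case=> [|k] /=; first by have [h1 h2 _] := halfP _ (B0 0%N); exact: half_sub.
  have [h1 h2 _] := halfP _ (filterI (V0 k) (B0 k.+1)).
  by move=> v /(half_sub h1 h2)[].
Qed.

Lemma nested_base : countable_base -> exists2 U, nested U &
  forall A, nbhs (0 : E) A -> exists k, U k `<=` A.
Proof.
move=> [B [B0 BA]]; have [U nU UB] := exists_nested B0.
exists U => // A /BA[k BkA]; exists k => v /UB; exact: BkA.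
Qed.

Section Nested.
Context (U : nat -> set E) (nU : nested U).

Lemma nestedS k : U k.+1 `<=` U k.
Proof. by have [U0 UD _] := nU; exact: (half_sub (U0 _) (UD k)). Qed.

Lemma nested_le m n : (m <= n)%N -> U n `<=` U m.
Proof.
move=> /subnK <-; elim: (n - m)%N => [//|k IH] v /nestedS; exact: IH.
Qed.

(** The estimate of a geometric series: after the first increment is split off, the tail is in
    [U m.+1] by induction for all [m], and one halving absorbs both, whatever the length [n]. *)
Lemma nested_sum (u : nat -> E) : (forall k, U k.+1 (u k.+1 - u k)) ->
  forall m n, U m (u (m + n)%N - u m).
Proof.
have [U0 UD _] := nU.
move=> uU m n; elim: n m => [|n IH] m.
  by rewrite addn0 subrr; exact: nbhs_singleton.
have -> : u (m + n.+1)%N - u m = (u (m.+1 + n)%N - u m.+1) + (u m.+1 - u m).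
  by rewrite addrA subrK addnS addSn.
exact: UD.
Qed.

Lemma nested_cauchy (u : nat -> E) :
  (forall A, nbhs (0 : E) A -> exists k, U k `<=` A) ->
  (forall k, U k.+1 (u k.+1 - u k)) -> cauchy_seq u.
Proof.
move=> UA uU A /UA[k UkA]; have [U0 UD UN] := nU.
exists k.+1 => m n km kn; apply: UkA.
have -> : u m - u n = (u m - u k.+1) - (u n - u k.+1).
  by rewrite opprB addrA subrK.
apply: UD; last apply: UN.
  by rewrite -(subnKC km); exact: nested_sum.
by rewrite -(subnKC kn); exact: nested_sum.
Qed.

End Nested.

End CountableBase.

Lemma closed_thicken (K : numFieldType) (E : tvsType K) (N : set E) z :
  closed N -> (forall W, nbhs (0 : E) W -> thicken W N z) -> N z.
Proof.
move=> Nc zN; apply: Nc => A /nbhs_translate /nbhs0_half[W [W0 WA WN]].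
have [n Nn Wzn] := zN _ W0; exists n; split=> //.
by have := half_sub W0 WA (WN _ Wzn) => /=; congr A; abel.
Qed.

Lemma submoduleB (K : nzRingType) (V : lmodType K) (M : set V) :
  submodule M -> forall v w, M v -> M w -> M (v - w).
Proof.
by move=> [_ MD MZ] v w Mv Mw; apply: MD => //; rewrite -scaleN1r; exact: MZ.
Qed.

Lemma submodule_preimage (K : nzRingType) (V W : lmodType K) (h : {linear V -> W})
    (M : set W) : submodule M -> submodule (h @^-1` M).
Proof.
move=> [M0 MD MZ]; split=> [|v w Mv Mw|k v Mv] /=; first by rewrite linear0.
- by rewrite linearD; exact: MD.
- by rewrite linearZ; exact: MZ.
Qed.

Lemma submodule_image (K : nzRingType) (V W : lmodType K) (h : {linear V -> W})
    (M : set V) : submodule M -> submodule (h @` M).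
Proof.
move=> [M0 MD MZ]; split=> [|_ _ [u Mu <-] [v Mv <-]|k _ [u Mu <-]].
- by exists 0 => //; rewrite linear0.
- by exists (u + v); [exact: MD|rewrite linearD].
- by exists (k *: u); [exact: MZ|rewrite linearZ].
Qed.

Lemma submodule0 (K : nzRingType) (V : lmodType K) : submodule [set (0 : V)].
Proof. by split=> [|v w /= -> ->|k v /= ->]; rewrite ?addr0 ?scaler0. Qed.

Lemma submoduleT (K : nzRingType) (V : lmodType K) : submodule [set: V].
Proof. by split. Qed.

(* z is corrected by h y_0, h y_1, ... and by elements of M, up to errors that
   tend to 0; the sum of the y_k converges by completeness, that of the
   corrections in M because M is closed. *)
Lemma successive_approximation (K : numFieldType) (E F : tvsType K)
    (h : {linear E -> F}) (M D : set F) :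
  continuous h -> countable_base E -> seq_complete E -> countable_base F ->
  submodule M -> closed M -> submodule D -> (forall y, D (h y)) -> M `<=` D ->
  (forall U, nbhs (0 : E) U -> exists2 V, nbhs (0 : F) V & forall z, V z -> D z ->
     forall W, nbhs (0 : F) W -> exists2 y, U y & thicken W M (z - h y)) ->
  forall U, nbhs (0 : E) U -> exists2 V, nbhs (0 : F) V & forall z, V z -> D z ->
     exists2 y, U y & M (z - h y).
Proof.
move=> hc /nested_base[P nP PA] Ec /nested_base[B nB BA] Mm Mc Dm Dh MD ao U U0.
have [W [W0 WD WN]] := nbhs0_half U0.
have [k0 Pk0] := PA _ W0.
(* The shift puts all partial sums of corrections into [Q 0], hence into [W]; the other half of [U]
   is spent on passing to the limit. *)
pose Q k := P (k0 + k)%N.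
have [P0 PD PN] := nP; have [B0 BD BN] := nB.
have nQ : nested Q.
  by split=> [k|k v w|k v] //; rewrite /Q ?addnS; [exact: P0|exact: PD|exact: PN].
have QA A : nbhs 0 A -> exists k, Q k `<=` A.
  move=> /PA[k PkA]; exists k => v; rewrite /Q => /(nested_le nP (leq_addl _ _)).
  exact: PkA.
have /choice[V VP'] (k : nat) : exists V, nbhs 0 V /\
    forall z, V z -> D z -> forall W, nbhs (0 : F) W ->
    exists2 y, Q k.+1 y & thicken W M (z - h y).
  have [Q0 _ _] := nQ.
  by have [V V0 VP] := ao _ (Q0 k.+1); exists V.
(* One correction, returning it with the new error. The error must lie in [V k.+1] for the iteration
   to continue, and in [B k.+1] to tend to 0. The value is junk off the invariant, which [zzP]
   maintains. *)
have /choice[step stepP] (p : nat * F) : exists q : E * F,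
    V p.1 p.2 -> D p.2 -> [/\ Q p.1.+1 q.1, V p.1.+1 q.2, B p.1.+1 q.2, D q.2 &
      M (p.2 - h q.1 - q.2)].
  case: p => k z /=.
  have [[Vz Dz]|nVD] := pselect (V k z /\ D z); last first.
    by exists (0, 0) => Vz Dz; exfalso; exact: nVD.
  have [_ /(_ z Vz Dz (V k.+1 `&` B k.+1))[|y Qy [m Mm' [Vm Bm]]]] := VP' k.
    by apply: filterI; [have [] := VP' k.+1|exact: B0].
  exists (y, z - h y - m) => _ _; split=> //=; last by rewrite opprB addrC subrK.
  apply: submoduleB => //; last exact: MD.
  exact: submoduleB.
exists (V 0%N) => [|z Vz Dz]; first by have [] := VP' 0%N.
pose zz := fix zz k := if k is k'.+1 then (step (k', zz k')).2 else z.
have zzP k : V k (zz k) /\ D (zz k).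
  elim: k => [//|k [Vk Dk]] /=.
  by have [] := stepP (k, zz k) Vk Dk.
pose y k := (step (k, zz k)).1.
have zP k : [/\ Q k.+1 (y k), B k.+1 (zz k.+1) & M (zz k - h (y k) - zz k.+1)].
  by have [Vk Dk] := zzP k; have [] := stepP (k, zz k) Vk Dk.
pose s n := \sum_(i < n) y i.
have sS k : s k.+1 - s k = y k by rewrite /s big_ord_recr /= addrAC subrr add0r.
have sQ k : Q k.+1 (s k.+1 - s k) by rewrite sS; have [] := zP k.
have [l sl] := Ec s (nested_cauchy nQ QA sQ).
have Wk n : W (s n).
  have := nested_sum nQ sQ 0 n; rewrite /s big_ord0 subr0 add0n.
  by rewrite /Q addn0 => /Pk0.
exists l.
  move/cvg_nbhs0 : (sl) => /(_ W W0)[N /(_ N (leqnn _))] /WN.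
  by rewrite opprB => WlN; rewrite -(subrK (s N) l); exact: WD.
have zM n : M (z - h (s n) - zz n).
  elim: n => [|n IH].
    by rewrite /s big_ord0 linear0 subr0 subrr; have [] := Mm.
  have -> : z - h (s n.+1) - zz n.+1 =
      (z - h (s n) - zz n) + (zz n - h (y n) - zz n.+1).
    have -> : h (s n.+1) = h (s n) + h (y n).
      by rewrite /s big_ord_recr linearD.
    by abel.
  by have [_ MD' _] := Mm; apply: MD' => //; have [] := zP n.
apply: Mc => A /nbhs_translate A0.
have [A1 [A10 A1A A1N]] := nbhs0_half A0.
have /cvg_nbhs0/(_ _ (continuous_nbhs0 hc A10))[N1 HN1] := sl.
have [k BkA] := BA _ A10.
pose n := (maxn N1 k).+1.
exists (z - h (s n) - zz n); split=> //.
have Bz : A1 (zz n).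
  apply: BkA; apply: (nested_le nB (leqW (leq_maxr N1 k))).
  by have [] := zP (maxn N1 k).
have := A1A _ _ (A1N _ (HN1 n (leqW (leq_maxl _ _)))) (A1N _ Bz).
have -> : h (s n - l) = h (s n) - h l by rewrite linearB.
by congr A; abel.
Qed.

(** * The open mapping theorem *)

(** Baire's theorem in [D]: the closure of some [S n] contains a relative neighbourhood of a point
    of [D]. Otherwise every relative neighbourhood contains a point of [D] with a neighbourhood that
    misses [S n]; iterating over [n] gives a Cauchy sequence whose limit lies in [D] and in no
    [S n]. *)
Lemma baire (K : numFieldType) (F : tvsType K) (D : set F) (S : nat -> set F) :
  countable_base F -> seq_complete F -> closed D -> D !=set0 ->
  D `<=` \bigcup_n S n ->
  exists n z0 V, [/\ D z0, nbhs (0 : F) V & forall z, D z -> V (z - z0) ->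
    forall W, nbhs (0 : F) W -> exists2 s, S n s & W (z - s)].
Proof.
move=> [B [B0 BA]] Fc Dc [d Dd] DS; apply: contrapT => nexist.
have bad n z0 V : D z0 -> nbhs (0 : F) V -> exists z, [/\ D z, V (z - z0) &
    exists2 W, nbhs (0 : F) W & forall s, S n s -> ~ W (z - s)].
  move=> Dz0 V0; apply: contrapT => nz; apply: nexist.
  exists n, z0, V; split=> // z Dz Vz W W0; apply: contrapT => ns.
  apply: nz; exists z; split=> //; exists W => // s Ss Ws; apply: ns.
  by exists s.
(* Three summands [a], [b], [c] appear because the limit is reached from [q.1] in three moves: the
   next increment, a finite tail, and the remaining distance to the limit. *)
have /choice[step stepP] (p : nat * (F * set F)) : exists q : F * set F,
    D p.2.1 -> nbhs (0 : F) p.2.2 ->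
    [/\ D q.1, p.2.2 (q.1 - p.2.1), nbhs (0 : F) q.2 &
    [/\ forall v w, q.2 v -> q.2 w -> p.2.2 (v + w), forall v, q.2 v -> q.2 (- v),
        q.2 `<=` B p.1 & forall a b c, q.2 a -> q.2 b -> q.2 c ->
        ~ S p.1 (q.1 + a + b + c)]].
  case: p => n [z0 V] /=.
  have [[Dz V0]|nDV] := pselect (D z0 /\ nbhs (0 : F) V); last first.
    by exists (0, set0) => Dz V0; exfalso; exact: nDV.
  have [z [Dz' Vz [W W0 WS]]] := bad n z0 V Dz V0.
  have [H [H0 HD HN]] := nbhs0_half (filterI (filterI V0 (B0 n)) W0).
  have [V' [V'0 V'D V'N]] := nbhs0_half H0.
  have V'H := half_sub V'0 V'D.
  exists (z, V') => _ _ /=; split=> //; split=> //.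
  - by move=> v w /V'H Hv /V'H Hw; have [[]] := HD _ _ Hv Hw.
  - by move=> v /V'H /(half_sub H0 HD)[[]].
  - move=> a b c /V'N Va /V'N Vb /V'N /V'H Hc /WS; apply.
    have [_] := HD _ _ (V'D _ _ Va Vb) Hc; congr W; abel.
pose st := fix st n := if n is n'.+1 then step (n', st n') else (d, setT).
have stD n : D (st n).1 /\ nbhs (0 : F) (st n).2.
  elim: n => [|n [Dn Vn]]; first by split => //; exact: filterT.
  by have [] := stepP (n, st n) Dn Vn.
have stP n := stepP (n, st n) (stD n).1 (stD n).2.
(* The index of [U] is shifted because the increment [u k.+1 - u k] lies in [(st k).2], and
   [nested_sum] expects it in [U k.+1]. *)
pose u n := (st n).1; pose U n := if n is n'.+1 then (st n').2 else setT.
have nU : nested U.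
  split=> [[|k]|[|k] v w|[|[|k]] v] //=; first exact: filterT.
  - by have [] := stD k.
  - by have [_ _ _ [+ _ _ _]] := stP k; exact.
  - by have [_ _ _ [_ + _ _]] := stP k; exact.
have UA A : nbhs (0 : F) A -> exists k, U k `<=` A.
  move=> /BA[k BkA]; exists k.+2 => v /= Uv; apply: BkA.
  by have [_ _ _ [_ _ + _]] := stP k; exact.
have uU k : U k.+1 (u k.+1 - u k) by have [_] := stP k.
have [z uz] := Fc u (nested_cauchy nU UA uU).
have Dz : D z by apply: (closed_cvg D) uz => //; apply: nearW => n; have [] := stD n.
have [n _ Sz] := DS _ Dz.
have [_ _ V0 [_ VN _ nS]] := stP n.
move/cvg_nbhs0 : uz => /(_ _ V0)[N NV].
apply: (nS (u n.+2 - u n.+1) (u (n.+2 + N)%N - u n.+2) (z - u (n.+2 + N)%N)).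
- by have := uU n.+1.
- by have := nested_sum nU uU n.+2 N.
- by rewrite -opprB; apply: VN; apply: NV; exact: leq_addl.
- by move: Sz; congr (S n); rewrite -/(u n.+1); abel.
Qed.

Lemma exists_inv_lt (R : realType) (e : R[i]) : 0 < e ->
  exists n : nat, n.+1%:R^-1 < e.
Proof.
move=> e0; have /complex_realP[r er] := gtr0_real e0.
rewrite er; move: e0; rewrite er ltcR => r0; exists (Num.bound r^-1).
rewrite -(@rmorph_nat R R[i] (real_complex R)) -fmorphV ltcR invf_plt ?posrE//.
apply: (lt_le_trans (archi_boundP _)); first by rewrite invr_ge0 ltW.
by rewrite ler_nat.
Qed.

Lemma nbhs0_absorbing_nat (R : realType) (E : tvsType R[i]) (U : set E) v :
  nbhs 0 U -> exists n : nat, U (n.+1%:R^-1 *: v).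
Proof.
move=> U0; have := @scale_continuous R[i] E (0, v) U; rewrite /= scale0r.
move=> /(_ U0)[[A B] [/= [e /= e0 eA] B0] AB].
have [n ne] := exists_inv_lt e0.
exists n; apply: (AB (n.+1%:R^-1, v)); split => /=; last exact: nbhs_singleton.
by apply: eA => /=; rewrite sub0r normrN gtr0_norm ?invr_gt0 ?ltr0n.
Qed.

(* The open mapping theorem for the map E -> D / M induced by h, without
   forming the quotient. *)
Lemma open_mapping (R : realType) (E F : tvsType R[i]) (h : {linear E -> F})
    (M D : set F) :
  continuous h -> countable_base E -> seq_complete E ->
  countable_base F -> seq_complete F ->
  submodule M -> closed M -> submodule D -> closed D ->
  (forall y, D (h y)) -> M `<=` D -> (forall z, D z -> exists y, M (z - h y)) ->
  forall U, nbhs (0 : E) U -> exists2 V, nbhs (0 : F) V & forall z, V z -> D z ->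
     exists2 y, U y & M (z - h y).
Proof.
move=> hc Eb Ec Fb Fc Mm Mc Dm Dc Dh MD DhM.
apply: (@successive_approximation _ _ _ h M D) => // U U0.
have [U' U'0 U'U] := nbhs0_sub U0.
(* The dilates [M + (n+1) h(U')] cover [D] because [U'] is absorbing and [h] is onto [D] modulo
   [M]. *)
pose S n : set F := [set s | exists2 y, U' y & M (s - n.+1%:R *: h y)].
have [M0 MD' MZ] := Mm; have [D0 DD DZ] := Dm.
have [|z Dz|n [z0 [V [Dz0 V0 VS]]]] := @baire _ F D S Fb Fc Dc.
- by exists 0.
- have [y My] := DhM z Dz; have [n Un] := nbhs0_absorbing_nat y U'0.
  exists n => //; exists (n.+1%:R^-1 *: y) => //.
  by rewrite [h _]linearZ /= scalerA divff ?scale1r// pnatr_eq0.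
exists [set z | V (n.+1%:R *: z)]; first exact: nbhs0_scale.
move=> z /= Vz Dz W /(nbhs0_scale n.+1%:R^-1) /nbhs0_sub[W' W'0 W'W].
(* Density near [z0] is moved to 0 by approximating [z0 + (n+1) z] and [z0] separately, subtracting,
   and dividing by [n+1]; the difference of the two preimages lies in [U' - U'], hence in [U]. *)
have [||s1 [y1 Uy1 My1] Ws1] := VS (z0 + n.+1%:R *: z) _ _ _ W'0.
- by apply: DD => //; exact: DZ.
- by rewrite addrAC subrr add0r.
have [|s2 [y2 Uy2 My2] Ws2] := VS z0 Dz0 _ _ W'0.
  by rewrite subrr; exact: nbhs_singleton.
exists (y1 - y2); first exact: U'U.
exists (n.+1%:R^-1 *: ((s1 - n.+1%:R *: h y1) - (s2 - n.+1%:R *: h y2))).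
  by apply: MZ; exact: submoduleB.
have := W'W _ _ Ws1 Ws2 => /=; congr W.
have n0 : n.+1%:R != 0 :> R[i] by rewrite pnatr_eq0.
have hB : h (y1 - y2) = h y1 - h y2 by rewrite linearB.
have e w : z - (h y1 - h y2) - n.+1%:R^-1 *: w =
    n.+1%:R^-1 *: (n.+1%:R *: z - (n.+1%:R *: h y1 - n.+1%:R *: h y2) - w).
  by rewrite !scalerBr !scalerA mulVf// !scale1r.
by rewrite hB e; congr (_ *: _); abel.
Qed.

(** * Tensor products and completions *)

Section Absconvex.
Context (K : numFieldType).

Definition locally_absconvex (E : tvsType K) : Prop := forall U, nbhs (0 : E) U ->
  exists V, [/\ nbhs (0 : E) V, absconvex V & V `<=` U].

Definition absconvex_base (E : tvsType K) : Prop :=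
  exists U : nat -> set E, [/\ forall k, nbhs (0 : E) (U k),
    forall k, absconvex (U k) & forall A, nbhs (0 : E) A -> exists k, U k `<=` A].

Lemma absconvex_base_countable (E : tvsType K) :
  absconvex_base E -> countable_base E.
Proof. by move=> [U [U0 _ UA]]; exists U. Qed.

End Absconvex.

Section TensorBase.
Context (K : numFieldType) (Y X : tvsType K).

Definition tens_hull (U : set Y) (V : set X) : set (tensor Y X) :=
  absconvex_hull [set tens y x | y in U & x in V].

Lemma tens_hull_absconvex U V : absconvex (tens_hull U V).
Proof. exact: absconvex_hull_absconvex. Qed.

Lemma tens_hull_tens (U : set Y) (V : set X) y x : U y -> V x -> tens_hull U V (tens y x).
Proof. by move=> Uy Vx; apply: sub_absconvex_hull; exists y => //; exists x. Qed.

Lemma tens_hull_sub (U : set Y) (V : set X) C : absconvex C ->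
  (forall y x, U y -> V x -> C (tens y x)) -> tens_hull U V `<=` C.
Proof.
by move=> aC UVC; apply: absconvex_hull_sub => // _ [y Uy [x Vx <-]]; exact: UVC.
Qed.

Lemma tens_hull_mono (U U' : set Y) (V V' : set X) : U `<=` U' -> V `<=` V' ->
  tens_hull U V `<=` tens_hull U' V'.
Proof.
move=> UU' VV'; apply: tens_hull_sub; first exact: tens_hull_absconvex.
by move=> y x /UU' Uy /VV' Vx; exact: tens_hull_tens.
Qed.

Lemma nbhs0_tens_hull U V : nbhs 0 U -> nbhs 0 V -> nbhs 0 (tens_hull U V).
Proof.
by move=> U0 V0; apply/nbhs0_tensor; exists (tens_hull U V) => //; exists U, V.
Qed.

Lemma nbhs0_tensE (A : set (tensor Y X)) : nbhs 0 A ->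
  exists U V, [/\ nbhs 0 U, nbhs 0 V & tens_hull U V `<=` A].
Proof. by move=> /nbhs0_tensor[_ [U [V [U0 V0 ->]]] UVA]; exists U, V. Qed.

Lemma tensor_locally_absconvex : locally_absconvex (tensor Y X).
Proof.
move=> A /nbhs0_tensE[U [V [U0 V0 UVA]]].
exists (tens_hull U V); split=> //; first exact: nbhs0_tens_hull.
exact: tens_hull_absconvex.
Qed.

Lemma tensor_absconvex_base : countable_base Y -> countable_base X ->
  absconvex_base (tensor Y X).
Proof.
move=> /nested_base[U nU UA] /nested_base[V nV VA].
have [[U0 _ _] [V0 _ _]] := (nU, nV).
exists (fun k => tens_hull (U k) (V k)); split=> [k|k|A].
- exact: nbhs0_tens_hull.
- exact: tens_hull_absconvex.
- move=> /nbhs0_tensE[P [Q [/UA[i UiP] /VA[j VjQ] PQA]]].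
  exists (maxn i j) => t tt; apply: PQA; move: t tt; apply: tens_hull_mono.
    by move=> y /(nested_le nU (leq_maxl i j)); exact: UiP.
  by move=> x /(nested_le nV (leq_maxr i j)); exact: VjQ.
Qed.

End TensorBase.

Section Completion.
Context (K : numFieldType) (E : tvsType K).

Lemma lproj_null (u v : cseq E) :
  lproj (@null_seq K E) u = lproj (@null_seq K E) v <->
  forall U, nbhs (0 : E) U -> exists N, forall n, (N <= n)%N -> U (u n - v n).
Proof.
rewrite lprojP lspan_id; last exact: null_seq_submodule.
exact: null_seqP.
Qed.

Lemma to_completion_is_linear : linear (@to_completion K E).
Proof.
move=> k x y; rewrite /to_completion -linearZ -linearD; congr (lproj _ _).
by apply: val_inj; apply/funext.
Qed.

HB.instance Definition _ := GRing.isLinear.Build K E (completion E) *:%R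
  (@to_completion K E) to_completion_is_linear.

Lemma to_completion_continuous : continuous (@to_completion K E).
Proof.
apply: linear_continuous0 => A /nbhs0_completion[_ [U [_ U0 ->]] UA].
apply: filterS U0 => t Ut; apply: UA; exists (mk_cseq (cauchy_cst t)).
by split=> //; exists 0%N.
Qed.

(** [E] carries the topology induced from its completion. The completion is topologized by
    absolutely convex neighbourhoods only, so [E] must have a base of them. *)
Lemma to_completion_reflect : locally_absconvex E -> forall U, nbhs (0 : E) U ->
  exists2 W, nbhs (0 : completion E) W & forall t, W (to_completion t) -> U t.
Proof.
move=> lE U /nbhs0_half[W [W0 WD _]]; have [V [V0 aV VW]] := lE _ W0.
exists (compl_set V).
  by apply/nbhs0_completion; exists (compl_set V) => //; exists V.
move=> t [u [/lproj_null tu [N NV]]]; have [M MW] := tu _ W0.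
rewrite -(subrK (u (maxn N M)) t); apply: WD.
  by apply: MW; exact: leq_maxr.
by apply/VW/NV; exact: leq_maxl.
Qed.

Lemma to_completion_dense (z : completion E) (W : set (completion E)) :
  nbhs 0 W -> exists t, W (z - to_completion t).
Proof.
move=> /nbhs0_completion[_ [U [_ U0 ->]] UW].
rewrite -(lreprK z); set u := lrepr z.
have [N NU] := cseqP u U0; exists (u N); apply: UW.
exists (u - mk_cseq (cauchy_cst (u N))); split; first by rewrite linearB.
by exists N => n Nn; exact: NU.
Qed.

Lemma completion_absconvex_base : absconvex_base E -> absconvex_base (completion E).
Proof.
move=> [U [U0 aU UA]]; exists (fun k => compl_set (U k)); split=> [k|k|A].
- by apply/nbhs0_completion; exists (compl_set (U k)) => //; exists (U k).
- by apply: compl_base0_absconvex; exists (U k).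
- move=> /nbhs0_completion[_ [V [_ V0 ->]] VA]; have [k UkV] := UA _ V0.
  exists k => z [u [zu [N NU]]]; apply: VA; exists u; split=> //.
  by exists N => n /NU; exact: UkV.
Qed.

(** A diagonal argument: approximate [Z k] by some [e k] in [E] up to [U k]. The sequence [e] is
    Cauchy in [E], and its class is the limit of [Z]. *)
Lemma completion_seq_complete : absconvex_base E -> seq_complete (completion E).
Proof.
move=> Eb Z Zc.
have [U nU UA] := nested_base (absconvex_base_countable (completion_absconvex_base Eb)).
have [U0 _ _] := nU.
have lE : locally_absconvex E.
  have [P [P0 aP PA]] := Eb.
  by move=> A /PA[k Pk]; exists (P k); split.
have /choice[e eP] (k : nat) := to_completion_dense (Z k) (U0 k).
have ec : cauchy_seq e.
  move=> A /(to_completion_reflect lE)[W /nbhs0_half[W1 [W10 W1W W1N]] WA].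
  have [W2 [W20 W2W1 W2N]] := nbhs0_half W10.
  have [k Uk] := UA _ W20; have [N NW] := Zc _ W20.
  exists (maxn N k) => m n; rewrite !geq_max => /andP[Nm km] /andP[Nn kn].
  apply: WA; rewrite linearB.
  have -> : to_completion (e m) - to_completion (e n) =
      (- (Z m - to_completion (e m)) + (Z m - Z n)) + (Z n - to_completion (e n)).
    by abel.
  apply: W1W.
    by apply: W2W1; [apply/W2N/Uk/(nested_le nU km)|exact: NW].
  apply: (half_sub W20 W2W1); apply: Uk; exact: (nested_le nU kn).
exists (lproj (@null_seq K E) (mk_cseq ec)).
apply/cvg_nbhs0 => A /nbhs0_half[W [W0 WA _]].
have [k Uk] := UA _ W0.
have [V [V0 [aV VW]]] : exists V, nbhs (0 : E) V /\ absconvex V /\ compl_set V `<=` W.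
  by move/nbhs0_completion : W0 => [_ [V [aV V0 ->]] VW]; exists V.
have [N NV] := ec _ V0.
exists (maxn N k) => n; rewrite geq_max => /andP[Nn kn].
rewrite -(subrK (to_completion (e n)) (Z n)) -addrA; apply: WA.
  by apply: Uk; exact: (nested_le nU kn).
apply: VW; exists (mk_cseq (cauchy_cst (e n)) - mk_cseq ec).
split; first by rewrite linearB.
by exists N => m Nm; exact: NV.
Qed.

End Completion.

Lemma completion_map_lproj (K : numFieldType) (E F : tvsType K)
    (h : {linear E -> F}) (hc : continuous h) (u : cseq E) :
  completion_map hc (lproj (@null_seq K E) u) = lproj (@null_seq K F) (cseq_map hc u).
Proof. exact: (lquot_mapE (cseq_map_null hc)). Qed.

Lemma completion_mapB (K : numFieldType) (E F : tvsType K)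
    (h : {linear E -> F}) (hc : continuous h) (z w : completion E) :
  completion_map hc (z - w) = completion_map hc z - completion_map hc w.
Proof. exact: linearB. Qed.

Section TensorLift.
Context (K : numFieldType) (Y X : tvsType K) (W : lmodType K) (b : Y -> X -> W).

Lemma fglift_is_linear :
  linear (fglift (fun p : Y * X => b p.1 p.2) : {freeg (Y * X)%type / K} -> W).
Proof.
set h := fglift _.
have addM : zmod_morphism h by exact: lift_is_additive.
have M0 : h 0 = 0 by have := addM 0 0; rewrite !subrr.
have MD u v : h (u + v) = h u + h v.
  by rewrite -{1}[v]opprK addM -[- v]sub0r addM M0 sub0r opprK.
move=> k D E; rewrite MD; congr +%R.
elim/freeg_ind_dom0: D => [|c z D _ _ IH]; first by rewrite scaler0 M0 scaler0.
rewrite scalerDr !MD scalerDr IH; congr +%R.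
have -> : k *: << c *g z >> = << (k * c) *g z >>.
  by apply/eqP/freeg_eqP => t; rewrite coeffZ !coeffU mulrA.
by rewrite /h !liftU scalerA.
Qed.

Lemma tensor_lift :
  (forall y1 y2 x, b (y1 + y2) x = b y1 x + b y2 x) ->
  (forall y x1 x2, b y (x1 + x2) = b y x1 + b y x2) ->
  (forall k y x, b (k *: y) x = k *: b y x) ->
  (forall k y x, b y (k *: x) = k *: b y x) ->
  exists L : {linear tensor Y X -> W}, forall y x, L (tens y x) = b y x.
Proof.
move=> bDl bDr bZl bZr.
have [h hU] : exists h : {linear {freeg (Y * X)%type / K} -> W},
    forall y x, h << (y, x) >> = b y x.
  pose h0 : {freeg (Y * X)%type / K} -> W := fglift (fun p : Y * X => b p.1 p.2).
  pose h : {linear {freeg (Y * X)%type / K} -> W} :=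
    HB.pack h0 (GRing.isLinear.Build K _ _ *:%R h0 fglift_is_linear).
  by exists h => y x; rewrite /h /= /h0 liftU scale1r.
have hker D : lspan (@tensor_rel K Y X) D -> h D = 0.
  move=> /(_ _ (submodule_preimage h (submodule0 W))); apply.
  move=> _ [y1 y2 x|y x1 x2|k y x|k y x] /=; rewrite !linearB ?linearZ /= !hU.
  - by rewrite bDl; abel.
  - by rewrite bDr; abel.
  - by rewrite scalerN bZl subrr.
  - by rewrite scalerN bZr subrr.
pose L0 (t : tensor Y X) : W := h (lrepr t).
have L0E D : L0 (lproj _ D) = h D.
  apply/eqP; rewrite -subr_eq0 -linearB; apply/eqP/hker.
  by apply/lprojP; rewrite lreprK.
have L0lin : linear L0.
  move=> k s t; rewrite -(lreprK s) -(lreprK t) -linearP !L0E.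
  by rewrite linearP.
pose L : {linear tensor Y X -> W} :=
  HB.pack L0 (GRing.isLinear.Build K _ _ *:%R L0 L0lin).
by exists L => y x; rewrite /L /= /tens L0E.
Qed.

End TensorLift.

Section TensB.
Context (K : numFieldType) (Y X : tvsType K).

Lemma tensBl (y1 y2 : Y) (x : X) : tens (y1 - y2) x = tens y1 x - tens y2 x.
Proof. by rewrite tensDl -scaleN1r tensZl scaleN1r. Qed.

Lemma tens0l (x : X) : tens (0 : Y) x = 0.
Proof. by rewrite -(subrr 0) tensBl subrr. Qed.

End TensB.

Lemma tensor_map_square (K : numFieldType) (Y1 Y2 Y3 Y4 X : tvsType K)
    (f : {linear Y1 -> Y2}) (g : {linear Y2 -> Y4})
    (h : {linear Y1 -> Y3}) (k : {linear Y3 -> Y4}) :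
  (forall y, g (f y) = k (h y)) -> forall t : tensor Y1 X,
  tensor_map g (tensor_map f t) = tensor_map k (tensor_map h t).
Proof.
move=> gfkh; elim/tensor_ind => [|c y x t IH]; first by rewrite !linear0.
by rewrite !linearP /= !tensor_mapE IH gfkh.
Qed.

Section RightExact.
Context (K : numFieldType) (Y1 Y2 Y3 X : tvsType K).
Context (f : {linear Y1 -> Y2}) (g : {linear Y2 -> Y3}).
Hypothesis fg : range f = g @^-1` [set 0].
Hypothesis gs : range g = setT.

Lemma tensor_map_comp0 (t : tensor Y1 X) : tensor_map g (tensor_map f t) = 0.
Proof.
elim/tensor_ind: t => [|k y x t IH]; first by rewrite !linear0.
rewrite !linearP /= !tensor_mapE IH addr0.
have -> : g (f y) = 0.
  have : range f (f y) by exists y.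
  by rewrite fg.
by rewrite tens0l scaler0.
Qed.

(* A set-theoretic section of g induces a linear inverse modulo the range of
   f (x) 1. *)
Lemma tensor_map_ker (t : tensor Y2 X) : tensor_map g t = 0 ->
  exists s : tensor Y1 X, t = tensor_map f s.
Proof.
pose S : set (tensor Y2 X) := range (tensor_map f : tensor Y1 X -> tensor Y2 X).
have Sm : submodule S by apply: submodule_image; exact: submoduleT.
have /choice[s sP] (y : Y3) : exists y2, g y2 = y.
  have [y2 _ <-] : range g y by rewrite gs.
  by exists y2.
have Sker y x : g y = 0 -> S (tens y x).
  move=> gy; have [y1 _ <-] : range f y by rewrite fg.
  by exists (tens y1 x) => //; rewrite tensor_mapE.
have sE y x : lproj S (tens (s (g y)) x) = lproj S (tens y x).
  apply/lprojP; apply: sub_lspan; rewrite -tensBl; apply: Sker.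
  by rewrite linearB /= sP subrr.
have [|y x1 x2|k y x|k y x|L LE] := @tensor_lift K Y3 X (lquot S)
    (fun y x => lproj S (tens (s y) x)).
- move=> y1 y2 x; by rewrite -lprojD -tensDl -(sE (s y1 + s y2)) linearD /= !sP.
- by rewrite tensDr lprojD.
- by rewrite -[RHS]linearZ /= -tensZl -(sE (k *: s y)) linearZ /= sP.
- by rewrite tensZr [LHS]linearZ.
(* [L] recovers the class of [u] modulo the range of [f (x) 1] from the image of [u], so whatever
   [g (x) 1] kills lies in that range. *)
have Lg u : L (tensor_map g u) = lproj S u.
  elim/tensor_ind: u => [|k y x u IH]; first by rewrite !linear0.
  by rewrite !linearP /= tensor_mapE LE IH sE.
move=> gt; have : lproj S t = 0 by rewrite -Lg gt linear0.
by move=> /lproj0; rewrite lspan_id// => -[u _ <-]; exists u.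
Qed.

Lemma tensor_map_hull (U : set Y2) (U' : set Y3) (V : set X) :
  (forall y, U' y -> exists2 z, U z & g z = y) ->
  forall t, tens_hull U' V t -> exists2 s, tens_hull U V s & tensor_map g s = t.
Proof.
move=> UU'; apply: tens_hull_sub => [a b _ _ ab [u Uu <-] [v Uv <-]|y x U'y Vx].
  exists (a *: u + b *: v); first exact: (tens_hull_absconvex ab).
  by rewrite linearD !linearZ.
have [z Uz <-] := UU' y U'y; exists (tens z x); first exact: tens_hull_tens.
by rewrite tensor_mapE.
Qed.

End RightExact.

Section Balanced.
Context (K : numFieldType) (A : banachAlgType K).
Context (Y : tvsRModType A) (X : tvsLModType A).

(** The uncompleted counterpart of [balanced_null]. No closure is taken, since a thickening by a
    neighbourhood absorbs it. *)
Definition balanced_span : set (tensor Y X) :=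
  lspan [set t | exists y a x, t = tens (ract y a) x - tens y (lact a x)].

Lemma balanced_span_submodule : submodule balanced_span.
Proof. exact: lspan_submodule. Qed.

Lemma balanced_null_closed : closed (@balanced_null K A Y X).
Proof. exact: closed_closure. Qed.

Lemma lspan_balanced_rel : lspan (@balanced_rel K A Y X) =
  (@to_completion K (tensor Y X)) @` balanced_span.
Proof.
apply/seteqP; split=> [z|_ [t tS <-]].
  apply; first exact: submodule_image balanced_span_submodule.
  move=> _ [y [a [x ->]]]; exists (tens (ract y a) x - tens y (lact a x)).
    by apply: sub_lspan; exists y, a, x.
  by rewrite linearB.
apply: (tS _ (submodule_preimage _ (lspan_submodule (@balanced_rel K A Y X)))).
move=> _ [y [a [x ->]]] /=; rewrite linearB; apply: sub_lspan.
by exists y, a, x.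
Qed.

Lemma thicken_to_completion (W : set (cptensor Y X)) : nbhs 0 W ->
  exists2 U, nbhs (0 : tensor Y X) U & forall t, thicken U balanced_span t ->
    thicken W (@balanced_null K A Y X) (to_completion t).
Proof.
move=> W0; exists (@to_completion K (tensor Y X) @^-1` W).
  by apply: continuous_nbhs0 => //; exact: to_completion_continuous.
move=> t [r Rr Wtr]; exists (to_completion r); last by rewrite -linearB.
by apply: subset_closure; rewrite lspan_balanced_rel; exists r.
Qed.

(** An element of the closed span is exchanged for a nearby element of the span, at the cost of one
    halving. With the previous lemma, [Y (x) X] modulo the span has the topology induced from the
    completed quotient. *)
Lemma thicken_of_completion (U : set (tensor Y X)) : nbhs 0 U ->
  exists2 W, nbhs (0 : cptensor Y X) W & forall t,
    thicken W (@balanced_null K A Y X) (to_completion t) ->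
    thicken U balanced_span t.
Proof.
move=> /(to_completion_reflect (@tensor_locally_absconvex _ _ _)).
move=> [W' W'0 W'U]; have [W [W0 WW' WN]] := nbhs0_half W'0.
exists W => // t [n Nn Wtn].
have [s [+ Wns]] : lspan (@balanced_rel K A Y X) `&` [set s | W (n - s)] !=set0.
  apply: Nn; apply/nbhs_translate; apply: filterS W0 => v /WN.
  by congr W; abel.
rewrite lspan_balanced_rel => -[r Rr rs]; exists r => //; apply: W'U.
have := WW' _ _ Wtn Wns; congr W'; rewrite linearB -rs /=; abel.
Qed.

Lemma balanced_lprojP (z w : cptensor Y X) :
  lproj (@balanced_null K A Y X) z = lproj (@balanced_null K A Y X) w <->
  balanced_null (z - w).
Proof. by rewrite lprojP lspan_id//; exact: balanced_null_submodule. Qed.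

End Balanced.

Arguments balanced_span {K A Y X} _.
Arguments balanced_span_submodule {K A} Y X.

(** * Embeddings modulo the balancing relations *)

Section BalancedMap.
Context (K : numFieldType) (A : banachAlgType K).
Context (Y Z : tvsRModType A) (X : tvsLModType A) (f : cmodmap Y Z).

Local Notation fT := (tensor_map f : tensor Y X -> tensor Z X).
Local Notation fC := (cptensor_map f : cptensor Y X -> cptensor Z X).

Lemma balanced_span_map t : balanced_span t -> balanced_span (fT t).
Proof.
move=> /(_ _ (submodule_preimage _ (balanced_span_submodule Z X))); apply.
move=> _ [y [a [x ->]]] /=; rewrite linearB /= !tensor_mapE cmodmap_act.
by apply: sub_lspan; exists (f y), a, x.
Qed.

Lemma balanced_span_lift : range f = setT -> forall t : tensor Z X, balanced_span t ->
  exists2 s : tensor Y X, balanced_span s & fT s = t.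
Proof.
move=> fs t /(_ _ (submodule_image _ (balanced_span_submodule Y X))); apply.
move=> _ [z [a [x ->]]]; have [y _ <-] : range f z by rewrite fs.
exists (tens (ract y a) x - tens y (lact a x)).
  by apply: sub_lspan; exists y, a, x.
by rewrite linearB /= !tensor_mapE cmodmap_act.
Qed.

Lemma cptensor_map_continuous : continuous fC.
Proof. exact: completion_map_continuous. Qed.

Lemma cptensor_map_tensor t : fC (to_completion t) = to_completion (fT t).
Proof. exact: completion_mapE. Qed.

Lemma cptensor_mapB z w : fC (z - w) = fC z - fC w.
Proof. exact: completion_mapB. Qed.

Lemma balanced_null_cptensor_map z : balanced_null z -> balanced_null (fC z).
Proof.
move=> zN; rewrite -(lspan_id (@balanced_null_submodule _ _ Z X)).
exact: balanced_null_map.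
Qed.

Lemma btensor_map_lproj z :
  btensor_map X f (lproj (@balanced_null K A Y X) z) = lproj _ (fC z).
Proof. exact: (lquot_mapE (@balanced_null_map _ _ _ _ _ f)). Qed.

(* [f (x) 1] is an embedding modulo the balancing relations. *)
Definition btensor_embedding : Prop :=
  forall W : set (tensor Y X), nbhs 0 W -> exists2 W', nbhs (0 : tensor Z X) W' &
    forall t, thicken W' balanced_span (fT t) -> thicken W balanced_span t.

Definition cbtensor_embedding : Prop :=
  forall W : set (cptensor Y X), nbhs 0 W -> exists2 W', nbhs (0 : cptensor Z X) W' &
    forall z, thicken W' (@balanced_null K A Z X) (fC z) ->
      thicken W (@balanced_null K A Y X) z.

(** From left to right, [z] is replaced by an algebraic tensor so close that both the difference and
    its image under [fC] are small. The completed form serves the open mapping and approximation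
    arguments, the algebraic one the reflection from a completion. *)
Lemma btensor_embeddingE : btensor_embedding <-> cbtensor_embedding.
Proof.
split=> fe W W0.
  have [W1 [W10 W1W W1N]] := nbhs0_half W0.
  have [U U0 UW1] := thicken_to_completion W10.
  have [V V0 VU] := fe _ U0.
  have [W2 W20 W2V] := thicken_of_completion V0.
  have [W3 [W30 W3W2 W3N]] := nbhs0_half W20.
  exists W3 => // z [n Nn Wzn].
  have [t [W1t W3t]] := to_completion_dense z
    (filterI W10 (continuous_nbhs0 cptensor_map_continuous W30)).
  have [m Nm W1m] : thicken W1 (@balanced_null K A Y X) (to_completion t).
    apply/UW1/VU/W2V; rewrite -cptensor_map_tensor; exists n => //.
    have {}W3t : W3 (fC z - fC (to_completion t)) by rewrite -cptensor_mapB.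
    by have := W3W2 _ _ Wzn (W3N _ W3t); congr W2; abel.
  exists m => //; have := W1W _ _ W1t W1m; congr W; abel.
have [U U0 UW] := thicken_of_completion W0.
have [V V0 VU] := fe _ U0.
have [W' W'0 W'V] := thicken_to_completion V0.
by exists W' => // t /W'V; rewrite -cptensor_map_tensor => /VU /UW.
Qed.

End BalancedMap.

Arguments balanced_null_cptensor_map {K A Y Z X} f {z} _.

Section BalancedExact.
Context (K : numFieldType) (A : banachAlgType K).
Context (Y1 Y2 Y3 : tvsRModType A) (X : tvsLModType A).
Context (f : cmodmap Y1 Y2) (g : cmodmap Y2 Y3).

Local Notation fC := (cptensor_map f : cptensor Y1 X -> cptensor Y2 X).
Local Notation gC := (cptensor_map g : cptensor Y2 X -> cptensor Y3 X).
Local Notation N1 := (@balanced_null K A Y1 X).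
Local Notation N2 := (@balanced_null K A Y2 X).
Local Notation N3 := (@balanced_null K A Y3 X).

Lemma btensor_short_exactP :
  short_exact (btensor_map X f) (btensor_map X g) <->
  [/\ forall z, N2 (fC z) -> N1 z,
      forall z, N3 (gC z) <-> exists y, N2 (z - fC y) &
      forall w, exists z, N3 (w - gC z)].
Proof.
have l0 (Y : tvsRModType A) z : lproj (@balanced_null K A Y X) z = 0 <-> balanced_null z.
  by rewrite lproj0 lspan_id//; exact: balanced_null_submodule.
split=> [[fi fgE gs]|[fi fgE gs]].
  split=> [z|z|w].
  - move=> /l0 Nz; apply/l0/fi; rewrite btensor_map_lproj Nz.
    by rewrite linear0.
  - rewrite -l0 -btensor_map_lproj.
    have := congr1 (fun P => P (lproj N2 z)) fgE => /= <-.
    split=> [[y _]|[y /balanced_lprojP ->]].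
      rewrite -(lreprK y) btensor_map_lproj => /esym/balanced_lprojP.
      by exists (lrepr y).
    by exists (lproj N1 y) => //; rewrite btensor_map_lproj.
  - have [z _] : range (btensor_map X g) (lproj N3 w) by rewrite gs.
    rewrite -(lreprK z) btensor_map_lproj => /esym/balanced_lprojP.
    by exists (lrepr z).
split.
- move=> u v uv; apply/eqP; rewrite -subr_eq0; apply/eqP; move: uv.
  move=> /eqP; rewrite -subr_eq0 -linearB -(lreprK (u - v)) /= btensor_map_lproj.
  by move=> /eqP/l0/fi/l0.
- apply/seteqP; split=> [_ [y _ <-]|z] /=; [rewrite -(lreprK y)|rewrite -(lreprK z)].
    rewrite !btensor_map_lproj; apply/l0/fgE; exists (lrepr y); rewrite subrr.
    by have [] := balanced_null_submodule Y2 X.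
  rewrite btensor_map_lproj => /l0/fgE[y /balanced_lprojP ->].
  by exists (lproj N1 y) => //; rewrite btensor_map_lproj.
- apply/seteqP; split=> // w _; have [z /balanced_lprojP zw] := gs (lrepr w).
  by exists (lproj N2 z) => //; rewrite btensor_map_lproj -zw lreprK.
Qed.

Hypothesis fg : range f = g @^-1` [set 0].

Lemma cptensor_map_comp0 z : gC (fC z) = 0.
Proof.
rewrite -(lreprK z) /cptensor_map !completion_map_lproj lproj0.
apply: sub_lspan; apply/null_seqP => U U0; exists 0%N => n _ /=.
by rewrite tensor_map_comp0//; exact: nbhs_singleton.
Qed.

Hypothesis gs : range g = setT.
Hypothesis g_open : forall U, nbhs (0 : Y2) U -> exists2 V, nbhs (0 : Y3) V &
  forall y, V y -> exists2 z, U z & g z = y.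

Lemma tensor_map_open (U : set (tensor Y2 X)) : nbhs 0 U ->
  exists2 V, nbhs (0 : tensor Y3 X) V &
    forall t, V t -> exists2 s, U s & tensor_map g s = t.
Proof.
move=> /nbhs0_tensE[P [Q [P0 Q0 PQU]]]; have [P' P'0 P'P] := g_open P0.
exists (tens_hull P' Q); first exact: nbhs0_tens_hull.
by move=> t /(tensor_map_hull P'P)[s /PQU Us <-]; exists s.
Qed.

(** Replace [z] by a nearby algebraic tensor [t]. Its image under [g (x) 1] is a balanced part plus
    a small part, and both lift: balancing relations because [g] is onto, small tensors because [g]
    is open. What remains of [t] is in the algebraic kernel, hence in the range of [f (x) 1]. *)
Lemma cptensor_map_dense z : N3 (gC z) -> forall W, nbhs 0 W ->
  exists y, thicken W N2 (z - fC y).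
Proof.
move=> gz W /nbhs0_half[W1 [W10 W1W _]].
have [U U0 UW1] := thicken_to_completion W10.
have [V V0 VU] := tensor_map_open U0.
have [W3 W30 W3V] := thicken_of_completion V0.
have [W4 [W40 W43 W4N]] := nbhs0_half W30.
have [t [W1t W4t]] := to_completion_dense z (filterI W10
  (continuous_nbhs0 (@cptensor_map_continuous _ _ _ _ X g) W40)).
have [r Rr /VU[s Us gs']] : thicken V (balanced_span (X := X)) (tensor_map g t).
  apply: W3V; rewrite -cptensor_map_tensor; exists (gC z) => //.
  have {}W4t : W4 (gC z - gC (to_completion t)) by rewrite -cptensor_mapB.
  by apply: (half_sub W40 W43); have := W4N _ W4t; congr W4; abel.
have [r' Rr' gr'] := balanced_span_lift gs Rr.
have [v tv] : exists v : tensor Y1 X, t - r' - s = tensor_map f v.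
  apply: (tensor_map_ker fg gs).
  by rewrite !linearB /= gr' gs' subrr.
have [n Nn W1n] : thicken W1 N2 (to_completion (r' + s)).
  by apply: UW1; exists r' => //; rewrite addrAC subrr add0r.
exists (to_completion v), n => //.
rewrite cptensor_map_tensor; have := W1W _ _ W1t W1n; congr W.
have -> : t = tensor_map f v + (r' + s) by rewrite -tv; abel.
have tD (a b : tensor Y2 X) : to_completion (a + b) = to_completion a + to_completion b.
  by rewrite linearD.
by rewrite !tD; abel.
Qed.

End BalancedExact.

(** * Exactness and embeddings *)

Lemma cptensor_absconvex_base (K : numFieldType) (Y X : tvsType K) :
  countable_base Y -> countable_base X -> absconvex_base (cptensor Y X).
Proof.
by move=> Yb Xb; apply: completion_absconvex_base; exact: tensor_absconvex_base.
Qed.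

Lemma cptensor_countable_base (K : numFieldType) (Y X : tvsType K) :
  countable_base Y -> countable_base X -> countable_base (cptensor Y X).
Proof. by move=> Yb Xb; apply/absconvex_base_countable/cptensor_absconvex_base. Qed.

Lemma cptensor_seq_complete (K : numFieldType) (Y X : tvsType K) :
  countable_base Y -> countable_base X -> seq_complete (cptensor Y X).
Proof.
by move=> Yb Xb; apply: completion_seq_complete; exact: tensor_absconvex_base.
Qed.

Lemma absorb_lift (K : numFieldType) (E F : tvsType K) (h : {linear E -> F})
    (M D V : set F) : submodule M -> submodule D -> nbhs 0 V ->
  (forall z, V z -> D z -> exists y, M (z - h y)) ->
  forall z, D z -> exists y, M (z - h y).
Proof.
move=> [_ _ MZ] [_ _ DZ] V0 VM z Dz; have [r r0 Vrz] := nbhs0_absorbing z V0.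
have [y /(MZ r^-1) My] := VM _ Vrz (DZ r z Dz).
exists (r^-1 *: y); move: My.
have -> : h (r^-1 *: y) = r^-1 *: h y by rewrite linearZ.
by rewrite scalerBr scalerA mulVf ?gt_eqF// scale1r.
Qed.

Section ExactOfEmbedding.
Context (K : numFieldType) (A : banachAlgType K).
Context (Y1 Y2 Y3 : tvsRModType A) (X : tvsLModType A).
Context (f : cmodmap Y1 Y2) (g : cmodmap Y2 Y3).
Hypotheses (Y1b : countable_base Y1) (Y2b : countable_base Y2)
  (Y3b : countable_base Y3) (Xb : countable_base X).
Hypotheses (fg : range f = g @^-1` [set 0]) (gs : range g = setT).
Hypothesis g_open : forall U, nbhs (0 : Y2) U -> exists2 V, nbhs (0 : Y3) V &
  forall y, V y -> exists2 z, U z & g z = y.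

Local Notation fC := (cptensor_map f : cptensor Y1 X -> cptensor Y2 X).
Local Notation gC := (cptensor_map g : cptensor Y2 X -> cptensor Y3 X).
Local Notation N1 := (@balanced_null K A Y1 X).
Local Notation N2 := (@balanced_null K A Y2 X).
Local Notation N3 := (@balanced_null K A Y3 X).

(** A small element is close to a small algebraic tensor, and this lifts exactly to a small tensor;
    successive approximation removes the error, and rescaling the smallness. *)
Lemma cptensor_map_surj w : exists z, N3 (w - gC z).
Proof.
have N3m := balanced_null_submodule Y3 X.
have Tm := submoduleT (cptensor Y3 X).
have [|V V0 VE] := successive_approximation
    (@cptensor_map_continuous _ _ _ _ X g) (cptensor_countable_base Y2b Xb)
    (cptensor_seq_complete Y2b Xb) (cptensor_countable_base Y3b Xb) N3m
    (@balanced_null_closed _ _ Y3 X) Tm (fun=> I) (fun _ _ => I) _ filterT.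
  move=> U U0.
  have [V V0 VU] := tensor_map_open g_open
    (continuous_nbhs0 (@to_completion_continuous _ (tensor Y2 X)) U0).
  have [W3 W30 W3V] := to_completion_reflect (@tensor_locally_absconvex _ _ _) V0.
  have [W4 [W40 W43 W4N]] := nbhs0_half W30.
  exists W4 => // z W4z _ W W0.
  have [t [Wt W4t]] := to_completion_dense z (filterI W0 W40).
  have [s Us st] : exists2 s : tensor Y2 X, U (to_completion s) & tensor_map g s = t.
    apply/VU/W3V; have := W43 _ _ W4z (W4N _ W4t); congr W3; abel.
  exists (to_completion s) => //; exists 0; first by have [] := N3m.
  by rewrite subr0; move: Wt; rewrite -st -cptensor_map_tensor.
by apply: (absorb_lift N3m Tm V0) => // z Vz _; have [y _] := VE z Vz I; exists y.
Qed.

Hypothesis fe : cbtensor_embedding X f.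

(** Density provides [y] with [fC y] close to [z] modulo [N2], but with no bound on [y]. The
    embedding bounds [y] modulo [N1], which gives the small corrections that successive
    approximation requires. *)
Lemma cptensor_map_ker z : N3 (gC z) -> exists y, N2 (z - fC y).
Proof.
have N2m := balanced_null_submodule Y2 X.
have N3m := balanced_null_submodule Y3 X.
pose D : set (cptensor Y2 X) := [set z | N3 (gC z)].
have Dm : submodule D by exact: (submodule_preimage (cptensor_map g) N3m).
have Df y : D (fC y).
  by have [N30 _ _] := N3m; move: N30; rewrite -(cptensor_map_comp0 fg y).
have ND : N2 `<=` D by move=> n; exact: (balanced_null_cptensor_map g).
have [|V V0 VE] := successive_approximation
    (@cptensor_map_continuous _ _ _ _ X f) (cptensor_countable_base Y1b Xb)
    (cptensor_seq_complete Y1b Xb) (cptensor_countable_base Y2b Xb) N2m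
    (@balanced_null_closed _ _ Y2 X) Dm Df ND _ filterT.
  move=> U /fe[V /nbhs0_half[V1 [V10 V1V V1N]] VU].
  exists V1 => // {}z V1z Dz W W0.
  have [y [n Nn [Wn V1n]]] := cptensor_map_dense fg gs g_open Dz (filterI W0 V10).
  have [_ ND2 NZ2] := N2m.
  (* [fC y + n] is the difference of [z] and the approximation error, both in [V1]. *)
  have [n1 Nn1 Uy] : thicken U N1 y.
    apply: VU; exists (- n); first by rewrite -scaleN1r; exact: NZ2.
    have := V1V _ _ V1z (V1N _ V1n); congr V; abel.
  exists (y - n1) => //; exists (n + fC n1).
    by apply: ND2 => //; exact: balanced_null_cptensor_map.
  have fB : fC (y - n1) = fC y - fC n1 by exact: cptensor_mapB.
  have e : z - fC (y - n1) - (n + fC n1) = z - fC y - n by rewrite fB; abel.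
  by move: Wn; rewrite -e.
by move=> Dz; apply: (absorb_lift N2m Dm V0) Dz => {}z Vz Dz; have [y _] := VE z Vz Dz; exists y.
Qed.

Lemma short_exact_of_embedding :
  short_exact (btensor_map X f) (btensor_map X g).
Proof.
apply/btensor_short_exactP; split=> [z Nfz|z|w]; last exact: cptensor_map_surj.
- apply: closed_thicken => [|W /fe[W' W'0]]; first exact: balanced_null_closed.
  by apply; exists (fC z) => //; rewrite subrr; exact: nbhs_singleton.
- split=> [|[y Ny]]; first exact: cptensor_map_ker.
  have := balanced_null_cptensor_map g Ny.
  by rewrite cptensor_mapB cptensor_map_comp0// subr0.
Qed.

End ExactOfEmbedding.

(** By exactness [fC] is onto the closed submodule [D] modulo [N2], so it is open onto it. If [fC z]
    is small modulo [N2], openness yields a small [y] with the same image modulo [N2], and [z - y]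
    is balanced by injectivity. *)
Lemma embedding_of_short_exact (R : realType) (A : banachAlgType R[i])
    (Y1 Y2 Y3 : tvsRModType A) (X : tvsLModType A)
    (f : cmodmap Y1 Y2) (g : cmodmap Y2 Y3) :
  countable_base Y1 -> countable_base Y2 -> countable_base X ->
  short_exact (btensor_map X f) (btensor_map X g) -> cbtensor_embedding X f.
Proof.
move=> Y1b Y2b Xb /btensor_short_exactP[fi fgE _] W W0.
have N2m := balanced_null_submodule Y2 X.
have N3m := balanced_null_submodule Y3 X.
pose gC : cptensor Y2 X -> cptensor Y3 X := cptensor_map g.
pose D : set (cptensor Y2 X) := [set z | balanced_null (gC z)].
have Dm : submodule D by exact: (submodule_preimage (cptensor_map g) N3m).
have Df y : D (cptensor_map f y).
  by apply/fgE; exists y; rewrite subrr; have [] := N2m.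
have ND : @balanced_null _ _ Y2 X `<=` D by move=> n; exact: (balanced_null_cptensor_map g).
have Dc : closed D.
  apply: closed_comp; last exact: balanced_null_closed.
  by move=> z _; exact: cptensor_map_continuous.
have [V V0 VE] := open_mapping (@cptensor_map_continuous _ _ _ _ X f)
  (cptensor_countable_base Y1b Xb) (cptensor_seq_complete Y1b Xb)
  (cptensor_countable_base Y2b Xb) (cptensor_seq_complete Y2b Xb)
  N2m (@balanced_null_closed _ _ Y2 X) Dm Dc Df ND (fun z => (fgE z).1) W0.
exists V => // z [n Nn Vn].
have [y Wy Ny] := VE _ Vn (submoduleB Dm (Df z) (ND _ Nn)).
exists (z - y); last by rewrite opprB addrC subrK.
apply: fi; have [_ ND2 _] := N2m.
have {}Ny : balanced_null (cptensor_map f z - n - cptensor_map f y) := Ny.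
have := ND2 _ _ Ny Nn; congr balanced_null.
have fB : cptensor_map f (z - y) = cptensor_map f z - cptensor_map f y.
  exact: cptensor_mapB.
by rewrite fB; abel.
Qed.

(** * Completion in a contractive seminorm *)

Section RealNorm.
Context (R : realType).

(** Norms over [R[i]] take values in [R[i]]; suprema, infima and limits of seminorms are formed in
    [R]. *)
Definition rnorm (V : normedZmodType R[i]) (x : V) : R := complex.Re `|x|.

Context (V : normedZmodType R[i]).
Implicit Types x y : V.

Lemma rnormE x : `|x| = (rnorm x)%:C%C.
Proof. by rewrite /rnorm RRe_real// normr_real. Qed.

Lemma rnorm_ge0 x : 0 <= rnorm x.
Proof. by rewrite -ler0c -rnormE. Qed.

Lemma rnormD x y : rnorm (x + y) <= rnorm x + rnorm y.
Proof. by rewrite -lecR rmorphD /= -!rnormE ler_normD. Qed.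

Lemma rnormN x : rnorm (- x) = rnorm x.
Proof. by rewrite /rnorm normrN. Qed.

End RealNorm.

Lemma rnormM (R : realType) (k l : R[i]) : rnorm (k * l) = rnorm k * rnorm l.
Proof. by apply: complexI; rewrite rmorphM -!rnormE normrM. Qed.

Lemma rnorm_real (R : realType) (r : R) : 0 <= r -> rnorm (r%:C%C : R[i]) = r.
Proof. by move=> r0; apply: complexI; rewrite -rnormE ger0_norm ?ler0c. Qed.

Lemma rnormZ (R : realType) (W : normedModType R[i]) (k : R[i]) (w : W) :
  rnorm (k *: w) = rnorm k * rnorm w.
Proof. by apply: complexI; rewrite rmorphM -(rnormE (k *: w)) normrZ (rnormE k) (rnormE w). Qed.

(** The reverse inequality is [qZ] for the inverse scalar. *)
Lemma semi_homogeneous (R : realType) (V : lmodType R[i]) (q : V -> R) :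
  (forall y, 0 <= q y) -> (forall (k : R[i]) y, q (k *: y) <= rnorm k * q y) ->
  forall (k : R[i]) y, q (k *: y) = rnorm k * q y.
Proof.
move=> q0 qZ k y; apply/eqP; rewrite eq_le qZ /=.
have [->|k0] := eqVneq k 0.
  by rewrite [rnorm 0]/rnorm normr0 mul0r q0.
rewrite -[y in leLHS](scalerK k0).
apply: le_trans (ler_wpM2l (rnorm_ge0 k) (qZ _ _)) _.
rewrite mulrA -rnormM divff//.
by rewrite /rnorm normr1 mul1r.
Qed.

Section NormNbhs.
Context (R : realType) (W : normedModType R[i]).

Lemma nbhs0_rnorm (U : set W) :
  nbhs 0 U <-> exists2 e : R, 0 < e & forall x, rnorm x < e -> U x.
Proof.
split=> [/nbhs_ballP[e /= e0 eU]|[e e0 eU]].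
  have /complex_realP[r er] := gtr0_real e0; move: e0 eU; rewrite er ltcR => r0 eU.
  exists r => // x xr; apply: eU.
  by rewrite -ball_normE /= sub0r normrN rnormE ltcR.
apply/nbhs_ballP; exists e%:C%C => /=; first by rewrite ltcR.
by move=> x; rewrite -ball_normE /= sub0r normrN rnormE ltcR; exact: eU.
Qed.

End NormNbhs.

(* Contractive for the module action, so that the completion of [Y] in [p] is
   a Banach module. *)
Record cseminorm (R : realType) (A : banachAlgType R[i]) (Y : tvsRModType A) :=
  CSeminorm {
    cseminorm_val :> Y -> R;
    cseminormD : forall x y, cseminorm_val (x + y) <= cseminorm_val x + cseminorm_val y;
    cseminormZ : forall (k : R[i]) x, cseminorm_val (k *: x) = rnorm k * cseminorm_val x;
    cseminorm_act : forall y a, cseminorm_val (ract y a) <= cseminorm_val y * rnorm a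
  }.

Section SeminormSpace.
Context (R : realType) (A : banachAlgType R[i]) (Y : tvsRModType A) (p : cseminorm Y).

Lemma cseminorm0 : p 0 = 0.
Proof.
have := cseminormZ p (0 : R[i]) 0.
by rewrite scaler0 /rnorm normr0 mul0r.
Qed.

Lemma cseminormN y : p (- y) = p y.
Proof. by rewrite -scaleN1r cseminormZ /rnorm normrN1 mul1r. Qed.

Lemma cseminorm_ge0 y : 0 <= p y.
Proof.
have := cseminormD p y (- y); rewrite subrr cseminorm0 cseminormN.
by rewrite -mulr2n pmulrn_lge0.
Qed.

Lemma cseminormB x y : `|p x - p y| <= p (x - y).
Proof.
have h1 := cseminormD p (x - y) y; have h2 := cseminormD p (- (x - y)) x.
rewrite cseminormN opprB !subrK in h1 h2.
by rewrite ler_norml; apply/andP; split; lra.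
Qed.

(* Y with the topology defined by p alone. *)
Definition pspace (q : cseminorm Y) : Type := Y.

HB.instance Definition _ := GRing.Lmodule.on (pspace p).

Definition pspace_base0 : set_system (pspace p) :=
  [set W | exists2 e : R, 0 < e & W = [set x : Y | p x < e]].

Lemma pspace_base0_neq0 : exists U, pspace_base0 U.
Proof. by eexists; exists 1. Qed.

Lemma pspace_base0_I U V : pspace_base0 U -> pspace_base0 V ->
  exists2 W, pspace_base0 W & W `<=` U `&` V.
Proof.
move=> [d d0 ->] [e e0 ->]; eexists.
  by exists (Num.min d e) => //; rewrite lt_min d0.
by move=> y /=; rewrite lt_min => /andP[].
Qed.

Lemma pspace_base0_scale (r : R[i]) U : 0 < r -> pspace_base0 U ->
  exists2 W, pspace_base0 W & forall w, W w -> U (r *: w).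
Proof.
move=> /gtr0_norm rE [e e0 ->]; have [r0|r0] := ltrP 0 (rnorm r).
  eexists; first by exists (e / rnorm r) => //; exact: divr_gt0.
  by move=> y /=; rewrite ltr_pdivlMr// mulrC -cseminormZ.
eexists; first by exists 1.
move=> y _ /=; rewrite cseminormZ (le_lt_trans _ e0)// mulr_le0_ge0//.
exact: cseminorm_ge0.
Qed.

Lemma pspace_base0_absconvex U : pspace_base0 U -> absconvex U.
Proof.
move=> [e e0 ->] a b v w ab /= pv pw.
apply: (le_lt_trans (cseminormD _ _ _)); rewrite !cseminormZ.
have {}ab : rnorm a + rnorm b <= 1 by rewrite -lecR rmorphD /= -!rnormE.
have a0 := rnorm_ge0 a; have b0 := rnorm_ge0 b.
have m : Num.max (p v) (p w) < e by rewrite gt_max pv.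
apply: le_lt_trans m.
apply: (@le_trans _ _ ((rnorm a + rnorm b) * Num.max (p v) (p w))).
  rewrite mulrDl lerD// ler_wpM2l// le_max lexx// orbT//.
by rewrite ler_piMl// le_max cseminorm_ge0.
Qed.

Lemma pspace_base0_absorbing U v : pspace_base0 U ->
  exists2 r : R[i], 0 < r & U (r *: v).
Proof.
move=> [e e0 ->]; have v0 := cseminorm_ge0 v.
have d0 : 0 < 1 + p v by rewrite ltr_pwDl.
exists (e / (1 + p v))%:C%C; first by rewrite ltcR divr_gt0.
rewrite /= cseminormZ rnorm_real; last by rewrite ltW// divr_gt0.
by rewrite mulrAC ltr_pdivrMr// ltr_pM2l// ltrDr.
Qed.

HB.instance Definition _ := Lmodule_isLocallyConvex.Build R[i] (pspace p)
  pspace_base0_neq0 pspace_base0_I pspace_base0_scale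
  pspace_base0_absconvex pspace_base0_absorbing.

Lemma nbhs0_pspace (U : set (pspace p)) :
  nbhs 0 U <-> exists2 e : R, 0 < e & forall y : Y, p y < e -> U y.
Proof.
split=> [[_ [e e0 ->] eU]|[e e0 eU]].
  by exists e => // y ye; apply: eU; rewrite /= subr0.
exists [set x : Y | p x < e]; first by exists e.
by move=> y /=; rewrite subr0; exact: eU.
Qed.

Lemma pspace_absconvex_base : absconvex_base (pspace p).
Proof.
exists (fun k => [set y : Y | p y < k.+1%:R^-1]); split=> [k|k|U /nbhs0_pspace[e e0 eU]].
- by apply/nbhs0_pspace; exists k.+1%:R^-1 => //; rewrite invr_gt0.
- by apply: pspace_base0_absconvex; exists k.+1%:R^-1 => //; rewrite invr_gt0.
- have [k ke] : exists k : nat, k.+1%:R^-1 < e.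
    have [|k] := @exists_inv_lt R e%:C%C; first by rewrite ltcR.
    rewrite -(@rmorph_nat R R[i] (real_complex R)) -fmorphV ltcR.
    by exists k.
  by exists k => y /= yk; apply: eU; exact: lt_trans ke.
Qed.

(** A new name, because this type takes its topology from a norm while [completion] already carries
    one; [nbhs0_completion_norm] identifies the two. *)
Definition ncompletion : Type := completion (pspace p).

HB.instance Definition _ := GRing.Lmodule.on ncompletion.

End SeminormSpace.

Section CompletionNorm.
Context (R : realType) (A : banachAlgType R[i]) (Y : tvsRModType A) (p : cseminorm Y).

Local Notation Z := (ncompletion p).
Local Notation cls := (lproj (@null_seq R[i] (pspace p))).
Local Notation pseq u := (fun n => p ((u : cseq (pspace p)) n)).

Definition cnorm (z : Z) : R := lim (pseq (lrepr z) @ \oo).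

Lemma cseq_cvg_seminorm (u : cseq (pspace p)) : cvgn (pseq u).
Proof.
have [_ _ Rc] := banach_frechet (R^o : completeNormedModType R).
have [|l ul] := Rc (pseq u); last by apply/cvg_ex; exists l.
move=> U /nbhs_ballP[e /= e0 eU].
have [|N HN] := @cseqP _ _ u [set y : Y | p y < e].
  by apply/nbhs0_pspace; exists e.
exists N => m n Nm Nn; apply: eU; rewrite -ball_normE /= sub0r normrN.
exact: le_lt_trans (cseminormB p _ _) (HN m n Nm Nn).
Qed.

Lemma cnorm_cvg (u : cseq (pspace p)) : pseq u @ \oo --> cnorm (cls u).
Proof.
set v := lrepr (cls u); have /lproj_null uv : cls u = cls v by rewrite lreprK.
apply/cvgrPdist_lt => e e0; have e20 : 0 < e / 2 by rewrite divr_gt0.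
have /cvgrPdist_lt/(_ _ e20)[N1 _ HN1] := @cseq_cvg_seminorm v.
have [|N2 HN2] := uv [set y : Y | p y < e / 2].
  by apply/nbhs0_pspace; exists (e / 2).
exists (maxn N1 N2) => // n /=; rewrite geq_max => /andP[n1 n2].
have := HN1 n n1; have := HN2 n n2; have := cseminormB p (u n) (v n).
rewrite /= -/(cnorm (cls u)); set a := cnorm _ => h1 h2 h3.
rewrite -(subrK (p (v n)) a) -addrA; apply: le_lt_trans (ler_normD _ _) _.
rewrite [e]splitr ltrD// distrC; exact: le_lt_trans h2.
Qed.

Lemma cnorm_le (u : cseq (pspace p)) (r : R) N :
  (forall n, (N <= n)%N -> p (u n) <= r) -> cnorm (cls u) <= r.
Proof.
move=> ur; have cr : (fun=> r) @ \oo --> r by exact: cvg_cst.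
apply: (ler_cvg_to (@cnorm_cvg u) cr).
by exists N => // n /ur.
Qed.

Lemma cnorm_lt (u : cseq (pspace p)) (r : R) :
  cnorm (cls u) < r -> exists N, forall n, (N <= n)%N -> p (u n) < r.
Proof.
rewrite -subr_gt0 => r0; have /cvgrPdist_lt/(_ _ r0)[N _ HN] := @cnorm_cvg u.
exists N => n /HN /=; rewrite ltr_norml => /andP[+ _].
by rewrite opprB ltrBrDr => h; lra.
Qed.

Lemma cnormD z w : cnorm (z + w) <= cnorm z + cnorm w.
Proof.
rewrite -(lreprK z) -(lreprK w); set u := lrepr z; set v := lrepr w.
rewrite -lprojD; apply: (ler_cvg_to (@cnorm_cvg (u + v))
  (cvgD (@cnorm_cvg u) (@cnorm_cvg v))).
by apply: nearW => n; exact: cseminormD.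
Qed.

Lemma cnormZ (k : R[i]) z : cnorm (k *: z) = rnorm k * cnorm z.
Proof.
rewrite -(lreprK z); set u := lrepr z; rewrite -[k *: _]linearZ.
apply: (cvg_unique (@Rhausdorff R) (@cnorm_cvg (k *: u))).
rewrite (_ : pseq (k *: u) = (fun n => rnorm k * p (u n))).
  by apply: cvgMl_tmp; exact: cnorm_cvg.
by apply/funext => n; exact: cseminormZ.
Qed.

Lemma cnorm_eq0 z : cnorm z = 0 -> z = 0.
Proof.
rewrite -(lreprK z); set u := lrepr z => z0.
apply/lproj0; apply: sub_lspan; apply/null_seqP => U /nbhs0_pspace[e e0 eU].
have [|N HN] := @cnorm_lt u e; first by rewrite z0.
by exists N => n /HN /eU.
Qed.

Let cnormC (z : Z) : R[i] := (cnorm z)%:C%C.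

Let cnormCD z w : cnormC (z + w) <= cnormC z + cnormC w.
Proof. by rewrite /cnormC -rmorphD lecR cnormD. Qed.

Let cnormCZ (k : R[i]) z : cnormC (k *: z) = `|k| * cnormC z.
Proof. by rewrite /cnormC cnormZ rmorphM rnormE. Qed.

Let cnormC_eq0 z : cnormC z = 0 -> z = 0.
Proof. by move=> /complexI /cnorm_eq0. Qed.

HB.instance Definition _ :=
  Lmodule_isNormed.Build R[i] (ncompletion p) cnormCD cnormCZ cnormC_eq0.

Lemma rnorm_cnorm (z : Z) : rnorm z = cnorm z.
Proof. by []. Qed.

End CompletionNorm.

(** Completeness of a normed module is a condition on Cauchy filters. Centres of balls of radius
    1/(k+1) that belong to [F] form a Cauchy sequence, and its limit is a limit of [F]. *)
Lemma normed_complete (R : realType) (Z : normedModType R[i]) :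
  seq_complete Z -> forall F : set_system Z, ProperFilter F -> cauchy F -> cvg F.
Proof.
move=> Zc F FF /cauchyP Fc.
have /choice[x xP] (k : nat) : exists x : Z, F (ball x k.+1%:R^-1).
  by apply: Fc; rewrite invr_gt0.
have inv_le m n : (m <= n)%N -> n.+1%:R^-1 <= m.+1%:R^-1 :> R[i].
  by move=> mn; rewrite lef_pV2 ?posrE// ler_nat ltnS.
have [|l xl] := Zc x.
  move=> U /nbhs_ballP[e /= e0 eU].
  have [k ke] : exists k : nat, k.+1%:R^-1 < e / 2.
    by apply: exists_inv_lt; rewrite divr_gt0.
  exists k => m n km kn; apply: eU.
  have [z [/= zm zn]] := filter_ex (filterI (xP m) (xP n)).
  move: zm zn; rewrite -!ball_normE /= sub0r normrN => zm zn.
  rewrite -(subrK z (x m)) -addrA (le_lt_trans (ler_normD _ _))// [e]splitr.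
  rewrite ltrD//; first exact: lt_le_trans zm (le_trans (inv_le _ _ km) (ltW ke)).
  by rewrite distrC; exact: lt_le_trans zn (le_trans (inv_le _ _ kn) (ltW ke)).
apply/cvg_ex; exists l => U /nbhs_ballP[e /= e0 eU].
have [k ke] : exists k : nat, k.+1%:R^-1 < e / 2.
  by apply: exists_inv_lt; rewrite divr_gt0.
have [|N xN] := (cvg_nbhs0 _ _).1 xl (ball (0 : Z) (e / 2)).
  by apply: nbhsx_ballx; rewrite divr_gt0.
apply: filterS (xP (maxn N k)) => y yx; apply: eU.
have := xN _ (leq_maxl N k); move: yx; rewrite -!ball_normE /= sub0r normrN => xy xl'.
rewrite -(subrK (x (maxn N k)) l) -addrA (le_lt_trans (ler_normD _ _))// [e]splitr.
rewrite ltrD//; first by rewrite distrC.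
exact: lt_le_trans xy (le_trans (inv_le _ _ (leq_maxr N k)) (ltW ke)).
Qed.

Section BanachCompletion.
Context (R : realType) (A : banachAlgType R[i]) (Y : tvsRModType A) (p : cseminorm Y).

Local Notation Z := (ncompletion p).
Local Notation cls := (lproj (@null_seq R[i] (pspace p))).

Lemma nbhs0_completion_norm (U : set Z) :
  nbhs (0 : completion (pspace p)) (U : set (completion (pspace p))) <->
  nbhs (0 : Z) U.
Proof.
rewrite nbhs0_rnorm; split=> [/nbhs0_completion[_ [V [aV V0 ->]] VU]|[e e0 eU]].
  have /nbhs0_pspace[e e0 eV] := V0; exists e => // z.
  rewrite rnorm_cnorm -(lreprK z) => /cnorm_lt[N HN]; apply: VU.
  by exists (lrepr z); split=> //; exists N => n /HN /eV.
(* Halving [e] restores the strict inequality, which becomes a weak one for the limit [cnorm]. *)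
apply/nbhs0_completion; exists (compl_set [set y : pspace p | p y < e / 2]).
  exists [set y : pspace p | p y < e / 2]; split=> //.
    by apply: pspace_base0_absconvex; exists (e / 2) => //; rewrite divr_gt0.
  by apply/nbhs0_pspace; exists (e / 2) => //; rewrite divr_gt0.
move=> _ [u [-> [N HN]]]; apply: eU; rewrite rnorm_cnorm.
have : cnorm (cls u) <= e / 2 by apply: (@cnorm_le _ _ _ _ _ _ N) => n /HN /ltW.
by move=> h; lra.
Qed.

Lemma ncompletion_seq_complete : seq_complete Z.
Proof.
move=> u uc.
have [|l ul] := @completion_seq_complete _ _ (pspace_absconvex_base p) u.
  by move=> U /nbhs0_completion_norm /uc.
exists l; apply/cvg_nbhs0 => U /nbhs0_completion_norm.
exact: ((cvg_nbhs0 (u : nat -> completion (pspace p)) l).1 ul U).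
Qed.

HB.instance Definition _ := Uniform_isComplete.Build (ncompletion p)
  (normed_complete ncompletion_seq_complete).

Definition pact (a : A) (y : pspace p) : pspace p := ract (y : Y) a.

Lemma pact_is_linear a : linear (pact a).
Proof. by move=> k y z; rewrite /pact ractDl ractZl. Qed.

HB.instance Definition _ a := GRing.isLinear.Build R[i] (pspace p) (pspace p) *:%R
  (pact a) (pact_is_linear a).

Lemma pact_continuous a : continuous (pact a).
Proof.
apply: linear_continuous0 => U /nbhs0_pspace[e e0 eU].
have a0 := rnorm_ge0 a; have a1 : 0 < 1 + rnorm a by rewrite ltr_pwDl.
apply/nbhs0_pspace; exists (e / (1 + rnorm a)); first by rewrite divr_gt0.
move=> y; rewrite ltr_pdivlMr// => ye; apply: eU.
apply: le_lt_trans (cseminorm_act p y a) _; apply: le_lt_trans ye.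
by rewrite ler_wpM2l ?cseminorm_ge0// lerDr.
Qed.

Definition ncract (z : Z) (a : A) : Z := completion_map (@pact_continuous a) z.

Lemma ncract_cls u a : ncract (cls u) a = cls (cseq_map (@pact_continuous a) u).
Proof. exact: completion_map_lproj. Qed.

Lemma ncractA z a b : ncract (ncract z a) b = ncract z (bmul a b).
Proof.
rewrite -(lreprK z) !ncract_cls; congr (lproj _ _).
by apply: val_inj; apply/funext => n; exact: ractA.
Qed.

Lemma ncractDl z w a : ncract (z + w) a = ncract z a + ncract w a.
Proof. exact: linearD. Qed.

Lemma ncractDr z a b : ncract z (a + b) = ncract z a + ncract z b.
Proof.
rewrite -(lreprK z) !ncract_cls -[RHS]lprojD; congr (lproj _ _).
by apply: val_inj; apply/funext => n; exact: ractDr.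
Qed.

Lemma ncractZl k z a : ncract (k *: z) a = k *: ncract z a.
Proof. exact: linearZ. Qed.

Lemma ncractZr k z a : ncract z (k *: a) = k *: ncract z a.
Proof.
rewrite -(lreprK z) !ncract_cls -[RHS]linearZ; congr (lproj _ _).
by apply: val_inj; apply/funext => n; exact: ractZr.
Qed.

Lemma ncract_norm z a : rnorm (ncract z a) <= rnorm z * rnorm a.
Proof.
rewrite !rnorm_cnorm -(lreprK z) ncract_cls.
apply: (ler_cvg_to (@cnorm_cvg _ _ _ _ _) (cvgMr_tmp (@cnorm_cvg _ _ _ _ _))).
by apply: nearW => n; exact: cseminorm_act.
Qed.

Lemma ncract_continuous : continuous (fun q : Z * A => ncract q.1 q.2).
Proof.
move=> [z0 a0] U /nbhs_translate /nbhs0_rnorm[e e0 eU] /=.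
have z1 : 0 < 1 + rnorm z0 by rewrite ltr_pwDl// rnorm_ge0.
have a1 : 0 < 1 + rnorm a0 by rewrite ltr_pwDl// rnorm_ge0.
pose d := e / 2 / (1 + rnorm a0); have d0 : 0 < d by rewrite !divr_gt0.
(* The bound 1 on [a - a0] gives [rnorm a <= 1 + rnorm a0], the factor that [d] divides out. *)
pose c := Num.min 1 (e / 2 / (1 + rnorm z0)).
have c0 : 0 < c by rewrite lt_min ltr01 !divr_gt0.
exists ([set z : Z | rnorm (z - z0) < d], [set a : A | rnorm (a - a0) < c]) => /=.
  split; apply/nbhs_translate/nbhs0_rnorm.
    by exists d => // z; rewrite /= addrC addKr.
  by exists c => // z; rewrite /= addrC addKr.
move=> [z a] /= [zd]; rewrite lt_min => /andP[a1' ac].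
rewrite -(subrK (ncract z0 a0) (ncract z a)) addrC; apply: eU.
have aN : ncract z a0 - ncract z0 a0 = ncract (z - z0) a0.
  by rewrite -scaleN1r -ncractZl -ncractDl scaleN1r.
have -> : ncract z a - ncract z0 a0 = ncract (z - z0) a + ncract z0 (a - a0).
  have -> : ncract (z - z0) a = ncract z a - ncract z0 a.
    by rewrite -(scaleN1r (ncract _ _)) -ncractZl -ncractDl scaleN1r.
  have -> : ncract z0 (a - a0) = ncract z0 a - ncract z0 a0.
    by rewrite -(scaleN1r (ncract _ _)) -ncractZr -ncractDr scaleN1r.
  abel.
apply: le_lt_trans (rnormD _ _) _; rewrite [e]splitr ltr_leD//.
  apply: le_lt_trans (ncract_norm _ _) _.
  apply: (@le_lt_trans _ _ (rnorm (z - z0) * (1 + rnorm a0))).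
    rewrite ler_wpM2l ?rnorm_ge0// -(subrK a0 a) (le_trans (rnormD _ _))//.
    by rewrite lerD2r ltW.
  by rewrite -ltr_pdivlMr.
apply: le_trans (ncract_norm _ _) _.
apply: (@le_trans _ _ ((1 + rnorm z0) * rnorm (a - a0))).
  by rewrite ler_wpM2r ?rnorm_ge0// lerDr.
by rewrite mulrC -ler_pdivlMr// ltW.
Qed.

HB.instance Definition _ := isRightModule.Build R[i] A (ncompletion p)
  ncractA ncractDl ncractDr ncractZl ncractZr ncract_continuous.

Definition ncompl : banachRModType A := ncompletion p.

Definition ninj (y : Y) : ncompl := to_completion (y : pspace p).

Lemma ninj_is_linear : linear ninj.
Proof. by move=> k x y; exact: (@to_completion_is_linear _ (pspace p)). Qed.

HB.instance Definition _ := GRing.isLinear.Build R[i] Y ncompl *:%R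
  ninj ninj_is_linear.

Lemma ninjD y y' : ninj (y + y') = ninj y + ninj y'.
Proof. by rewrite -[y in LHS]scale1r ninj_is_linear scale1r. Qed.

Lemma ninjZ k y : ninj (k *: y) = k *: ninj y.
Proof.
have n0 : ninj 0 = 0 by apply: (addrI (ninj 0)); rewrite -ninjD !addr0.
by rewrite -[k *: y]addr0 ninj_is_linear n0 addr0.
Qed.

Lemma ninjN y : ninj (- y) = - ninj y.
Proof. by rewrite -scaleN1r ninjZ scaleN1r. Qed.

Lemma ninj_act y a : ninj (ract y a) = ract (ninj y) a.
Proof. by rewrite /ninj /ract /= /ncract completion_mapE. Qed.

Lemma rnorm_ninj y : rnorm (ninj y) = p y.
Proof.
have cy : (fun n => p (mk_cseq (cauchy_cst (y : pspace p)) n)) @ \oo --> p y.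
  exact: (cvg_cst (p y)).
exact: (cvg_unique (@Rhausdorff R) (@cnorm_cvg _ _ _ p _) cy).
Qed.

Lemma ninj_dense (z : ncompl) (e : R) : 0 < e -> exists y, rnorm (z - ninj y) < e.
Proof.
move=> e0; have [|y zy] := @to_completion_dense _ (pspace p) z [set z : ncompl | rnorm z < e].
  by apply/nbhs0_completion_norm/nbhs0_rnorm; exists e.
by exists y.
Qed.

End BanachCompletion.

Section CompletionFunctor.
Context (R : realType) (A : banachAlgType R[i]) (Y Y' : tvsRModType A).
Context (p : cseminorm Y) (p' : cseminorm Y') (h : {linear Y -> Y'}).
Hypothesis hp : forall y, p' (h y) <= p y.
Hypothesis h_act : forall y a, h (ract y a) = ract (h y) a.

Lemma ncompl_map : exists2 F : cmodmap (ncompl p) (ncompl p'),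
  forall y, F (ninj p y) = ninj p' (h y) & forall z, rnorm (F z) <= rnorm z.
Proof.
pose h0 : pspace p -> pspace p' := h.
have h0_lin : linear h0 by move=> k y z; exact: (linearP h).
pose h1 : {linear pspace p -> pspace p'} :=
  HB.pack h0 (GRing.isLinear.Build _ _ _ _ h0 h0_lin).
have h1c : continuous h1.
  apply: linear_continuous0 => U /nbhs0_pspace[e e0 eU].
  by apply/nbhs0_pspace; exists e => // y ye; apply: eU; exact: le_lt_trans (hp y) ye.
pose F0 : ncompl p -> ncompl p' := completion_map h1c.
have F0_lin : linear F0 by exact: completion_map_is_linear.
pose F1 : {linear ncompl p -> ncompl p'} :=
  HB.pack F0 (GRing.isLinear.Build _ _ _ _ F0 F0_lin).
have Fcls u : F1 (lproj _ u) = lproj _ (cseq_map h1c u) by exact: completion_map_lproj.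
have F1_norm z : rnorm (F1 z) <= rnorm z.
  rewrite -(lreprK z) Fcls !rnorm_cnorm.
  apply: (ler_cvg_to (@cnorm_cvg _ _ _ _ _) (@cnorm_cvg _ _ _ _ _)).
  by apply: nearW => n; exact: hp.
have F1c : continuous F1.
  apply: linear_continuous0 => U /nbhs0_rnorm[e e0 eU].
  apply/nbhs0_rnorm; exists e => // z ze; apply: eU.
  exact: le_lt_trans (F1_norm z) ze.
have F1_act z a : F1 (ract z a) = ract (F1 z) a.
  rewrite -(lreprK z); set u := lrepr z.
  have -> : ract (lproj _ u : ncompl p) a = lproj _ (cseq_map (@pact_continuous _ _ _ p a) u).
    exact: ncract_cls.
  rewrite !Fcls.
  have -> : ract (lproj _ (cseq_map h1c u) : ncompl p') a =
      lproj _ (cseq_map (@pact_continuous _ _ _ p' a) (cseq_map h1c u)).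
    exact: ncract_cls.
  by congr (lproj _ _); apply: val_inj; apply/funext => n; exact: h_act.
exists (CModMap F1c F1_act) => //= y.
exact: completion_mapE.
Qed.

End CompletionFunctor.

(** * Exact sequences of completions *)

Lemma normed_countable_base (R : realType) (Z : normedModType R[i]) : countable_base Z.
Proof.
exists (fun k => ball (0 : Z) k.+1%:R^-1); split=> [k|U /nbhs_ballP[e /= e0 eU]].
  by apply: nbhsx_ballx; rewrite invr_gt0.
have [k ke] := exists_inv_lt e0; exists k => z zk; apply: eU.
by apply: le_ball zk; exact: ltW.
Qed.

Lemma banach_seq_complete (K : numFieldType) (Z : completeNormedModType K) : seq_complete Z.
Proof. by have [] := banach_frechet Z. Qed.

Section ContractiveSeminorms.
Context (R : realType) (A : banachAlgType R[i]) (Y1 Y2 : tvsRModType A).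
Context (f : cmodmap Y1 Y2) (q : cseminorm Y2).

Let qf (y : Y1) : R := q (f y).

Let qfD x y : qf (x + y) <= qf x + qf y.
Proof. by rewrite /qf linearD cseminormD. Qed.

Let qfZ (k : R[i]) x : qf (k *: x) = rnorm k * qf x.
Proof. by rewrite /qf linearZ cseminormZ. Qed.

Let qf_act y a : qf (ract y a) <= qf y * rnorm a.
Proof. by rewrite /qf cmodmap_act cseminorm_act. Qed.

Definition comp_cseminorm : cseminorm Y1 := CSeminorm qfD qfZ qf_act.

(** The quotient seminorm of [Y2 / f(Y1)], read on [Y2]. The quotient need not be formed: elements
    of seminorm 0, among them the range of [f], vanish in the completion. *)
Definition quot_val (y : Y2) : R := inf [set q (y + f x) | x in setT].

Lemma quot_val_le y x : quot_val y <= q (y + f x).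
Proof.
apply: ge_inf; last by exists x.
by exists 0 => _ [z _ <-]; exact: cseminorm_ge0.
Qed.

Lemma le_quot_val y c : (forall x, c <= q (y + f x)) -> c <= quot_val y.
Proof.
move=> cq; apply: lb_le_inf; first by exists (q (y + f 0)), 0.
by move=> _ [x _ <-].
Qed.

Lemma quot_val_lt y e : quot_val y < e -> exists x, q (y + f x) < e.
Proof.
move=> ye; apply: contrapT => nx; move: ye; apply/negP; rewrite -leNgt.
by apply: le_quot_val => x; rewrite leNgt; apply/negP => xe; apply: nx; exists x.
Qed.

Lemma quot_val_ge0 y : 0 <= quot_val y.
Proof. by apply: le_quot_val => x; exact: cseminorm_ge0. Qed.

Let qbD x y : quot_val (x + y) <= quot_val x + quot_val y.
Proof.
rewrite -lerBlDr; apply: le_quot_val => a; rewrite lerBlDr -lerBlDl.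
apply: le_quot_val => b; rewrite lerBlDl.
apply: le_trans (quot_val_le _ (a + b)) _.
by rewrite linearD addrACA cseminormD.
Qed.

Let qbZ_le (k : R[i]) y : quot_val (k *: y) <= rnorm k * quot_val y.
Proof.
have h x : quot_val (k *: y) <= rnorm k * q (y + f x).
  by rewrite -cseminormZ scalerDr -linearZ; exact: quot_val_le.
have := rnorm_ge0 k; rewrite le_eqVlt => /predU1P[k0|k0].
  by have := h 0; rewrite -k0 !mul0r.
rewrite -ler_pdivrMl//; apply: le_quot_val => x.
by rewrite ler_pdivrMl.
Qed.

Let qbZ (k : R[i]) y : quot_val (k *: y) = rnorm k * quot_val y.
Proof.
exact: semi_homogeneous quot_val_ge0 qbZ_le k y.
Qed.

Let qb_act y a : quot_val (ract y a) <= quot_val y * rnorm a.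
Proof.
have h x : quot_val (ract y a) <= q (y + f x) * rnorm a.
  apply: le_trans (cseminorm_act q _ _); rewrite ractDl -cmodmap_act.
  exact: quot_val_le.
have := rnorm_ge0 a; rewrite le_eqVlt => /predU1P[a0|a0].
  by have := h 0; rewrite -a0 !mulr0.
rewrite -ler_pdivrMr//; apply: le_quot_val => x.
by rewrite ler_pdivrMr.
Qed.

Definition quot_cseminorm : cseminorm Y2 := CSeminorm qbD qbZ qb_act.

Lemma quot_cseminorm_f x : quot_cseminorm (f x) = 0.
Proof.
apply/eqP; rewrite eq_le quot_val_ge0 andbT.
apply: le_trans (quot_val_le _ (- x)) _.
by rewrite linearN subrr cseminorm0.
Qed.

(** [F] is isometric because it is so on a dense subspace, and [G] extends the identity of [Y2]. If
    [G z = 0], a nearby [y2] has small quotient seminorm, so [y2 + f x] is small for some [x] and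
    [z] is close to the image of [- x]. Successive approximation makes this exact, and likewise for
    the surjectivity of [G]. *)
Lemma ncompl_exact :
  exists (F : cmodmap (ncompl comp_cseminorm) (ncompl q))
         (G : cmodmap (ncompl q) (ncompl quot_cseminorm)),
  short_exact F G /\ forall y, F (ninj comp_cseminorm y) = ninj q (f y).
Proof.
have [F Fi Fn] := @ncompl_map _ _ _ _ comp_cseminorm q f
  (fun y => lexx (q (f y))) (cmodmap_act f).
have [||G Gi Gn] := @ncompl_map _ _ _ _ q quot_cseminorm idfun.
- by move=> y /=; apply: le_trans (quot_val_le _ 0) _; rewrite linear0 addr0.
- by [].
have Gi' y : G (ninj q y) = ninj quot_cseminorm y by rewrite Gi.
set i1 := ninj comp_cseminorm; set i2 := ninj q; set i3 := ninj quot_cseminorm.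
have FB z w : F (z - w) = F z - F w by rewrite linearB.
have GB z w : G (z - w) = G z - G w by rewrite linearB.
have i3f x : i3 (f x) = 0.
  apply/eqP; rewrite -normr_eq0 rnormE; apply/eqP.
  by rewrite rnorm_ninj quot_cseminorm_f.
have small0 (Z : normedModType R[i]) (z : Z) :
    (forall e, 0 < e -> rnorm z <= e) -> z = 0.
  move=> ze; apply/eqP; rewrite -normr_eq0 rnormE.
  have -> : rnorm z = 0; last by [].
  apply/eqP; rewrite eq_le rnorm_ge0 andbT; apply/ler_addgt0Pr => e e0.
  by rewrite add0r; exact: ze.
have Fiso z : rnorm z <= rnorm (F z).
  apply/ler_addgt0Pr => e e0; have [|y zy] := ninj_dense z (e := e / 2).
    by rewrite divr_gt0.
  have h1 : rnorm z <= rnorm (z - i1 y) + rnorm (i1 y).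
    by rewrite -{1}(subrK (i1 y) z) rnormD.
  have h2 : rnorm (F (i1 y)) <= rnorm (F z) + rnorm (F (z - i1 y)).
    have -> : F (i1 y) = F z - F (z - i1 y) by rewrite FB; abel.
    by rewrite (le_trans (rnormD _ _))// rnormN.
  have h3 := Fn (z - i1 y); have h4 : rnorm (F (i1 y)) = rnorm (i1 y).
    by rewrite Fi !rnorm_ninj.
  by move: zy; rewrite -/i1 => zy; lra.
have GF z : G (F z) = 0.
  apply: small0 => e e0; have [y zy] := ninj_dense z e0.
  have -> : G (F z) = G (F (z - i1 y)) by rewrite FB GB Fi Gi' -/i3 i3f subr0.
  exact: le_trans (le_trans (Gn _) (Fn _)) (ltW zy).
have clo0 (Z : normedModType R[i]) : closed [set (0 : Z)].
  exact/accessible_closed_set1/hausdorff_accessible/norm_hausdorff.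
exists F, G; split=> //; split.
- move=> z w /eqP; rewrite -subr_eq0 -FB => /eqP Fzw.
  apply/eqP; rewrite -subr_eq0; apply/eqP/small0 => e e0.
  by apply: le_trans (Fiso _) _; rewrite Fzw /rnorm normr0 ltW.
- apply/seteqP; split=> [_ [z _ <-]|z0 /= Gz0]; first exact: (GF z).
  pose D : set (ncompl q) := [set z | G z = 0].
  have Dm : submodule D by exact: (submodule_preimage G (submodule0 _)).
  have [||V V0 VE] := @successive_approximation _ _ _ F [set 0] D
      (cmodmap_continuous F)
      (@normed_countable_base _ _) (@banach_seq_complete _ _)
      (@normed_countable_base _ _) (submodule0 _) (@clo0 _) Dm GF _ _ _ filterT.
  + by move=> _ ->; rewrite /D /= linear0.
  + move=> U /nbhs0_rnorm[e e0 eU].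
    exists [set z | rnorm z < e / 2].
      by apply/nbhs0_rnorm; exists (e / 2) => //; rewrite divr_gt0.
    move=> z /= ze Dz W /nbhs0_rnorm[d d0 dW].
    (* Two errors below [c] add up: to less than [d], so that the remainder is in [W], and to less
       than [e / 2], so that the correction stays below [e]. *)
    pose c := Num.min d (e / 2) / 2.
    have c0 : 0 < c by rewrite divr_gt0// lt_min d0 divr_gt0.
    have cd : c + c <= d by rewrite -splitr ge_min lexx.
    have ce : c + c <= e / 2 by rewrite -splitr ge_min lexx orbT.
    have [y2 zy2] := ninj_dense z c0.
    have [x qx] : exists x, q (y2 + f x) < c.
      apply: quot_val_lt; rewrite -[quot_val _]/(quot_cseminorm y2) -rnorm_ninj -Gi'.
      have -> : G (i2 y2) = - G (z - i2 y2) by rewrite GB Dz; abel.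
      by rewrite rnormN; exact: le_lt_trans (Gn _) zy2.
    have zF : rnorm (z - F (i1 (- x))) < c + c.
      have -> : z - F (i1 (- x)) = (z - i2 y2) + i2 (y2 + f x).
        have -> : i2 (y2 + f x) = i2 y2 + i2 (f x) by exact: ninjD.
        have -> : F (i1 (- x)) = - i2 (f x) by rewrite Fi linearN ninjN.
        by abel.
      apply: le_lt_trans (rnormD _ _) _; apply: ltrD => //.
      by rewrite rnorm_ninj.
    exists (i1 (- x)).
      apply: eU; apply: le_lt_trans (Fiso _) _.
      have -> : F (i1 (- x)) = z - (z - F (i1 (- x))) by abel.
      apply: le_lt_trans (rnormD _ _) _; rewrite rnormN [e]splitr ltrD//.
      exact: lt_le_trans zF ce.
    by exists 0 => //; rewrite subr0; apply: dW; exact: lt_le_trans zF cd.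
  have [|y Fy] := @absorb_lift _ _ _ F [set 0] D V (submodule0 _) Dm V0 _ z0 Gz0.
    by move=> z Vz Dz; have [y _] := VE z Vz Dz; exists y.
  by exists y => //; apply/esym/eqP; rewrite -subr_eq0; apply/eqP.
- apply/seteqP; split=> // z0 _.
  have Tm := submoduleT (ncompl quot_cseminorm).
  have [|V V0 VE] := @successive_approximation _ _ _ G [set 0] setT
      (cmodmap_continuous G)
      (@normed_countable_base _ _) (@banach_seq_complete _ _)
      (@normed_countable_base _ _) (submodule0 _) (@clo0 _) Tm (fun=> I) (fun _ _ => I) _ _ filterT.
    move=> U /nbhs0_rnorm[e e0 eU].
    exists [set z | rnorm z < e]; first by apply/nbhs0_rnorm; exists e.
    move=> z /= ze _ W /nbhs0_rnorm[d d0 dW].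
    (* The margin [e - rnorm z] keeps the quotient seminorm of [y] below [e], so that [y] can be
       shifted by some [f x] to have [q] below [e]. *)
    pose c := Num.min d (e - rnorm z).
    have c0 : 0 < c by rewrite lt_min d0 subr_gt0.
    have [y zy] := ninj_dense z c0; move: zy; rewrite lt_min => /andP[zyd zye].
    have [x qx] : exists x, q (y + f x) < e.
      apply: quot_val_lt; rewrite -[quot_val _]/(quot_cseminorm y) -rnorm_ninj -/i3.
      have -> : i3 y = z - (z - i3 y) by abel.
      apply: le_lt_trans (rnormD _ _) _; rewrite rnormN.
      by move: zye; rewrite -/i3 => zye; lra.
    exists (i2 (y + f x)); first by apply: eU; rewrite rnorm_ninj.
    exists 0 => //; apply: dW; rewrite subr0 Gi'.
    have -> : ninj quot_cseminorm (y + f x) = i3 y + i3 (f x).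
      by exact: ninjD.
    by rewrite i3f addr0.
  have [|y Gy] := @absorb_lift _ _ _ G [set 0] setT V (submodule0 _) Tm V0 _ z0 I.
    by move=> z Vz _; have [y _] := VE z Vz I; exists y.
  by exists y => //; apply/esym/eqP; rewrite -subr_eq0; apply/eqP.
Qed.

End ContractiveSeminorms.

(** * Tensors over a completion *)

Section Reflection.
Context (R : realType) (A : banachAlgType R[i]).
Context (Y : tvsRModType A) (X : banachLModType A) (p : cseminorm Y) (V : set X).
Hypothesis V0 : nbhs 0 V.

Local Notation Z := (ncompl p).
Local Notation T := (tensor Y X).
Local Notation H e := (tens_hull [set y : Y | p y < e] V).
Local Notation span := (@balanced_span _ A Y X).

Lemma tens_hull_scale (k : R[i]) (d e : R) t : 0 < e -> rnorm k * d <= e ->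
  H d t -> H e (k *: t).
Proof.
move=> e0 kde; move: t; apply: tens_hull_sub.
  by apply: absconvex_preimageZ; exact: tens_hull_absconvex.
move=> y x /= py Vx; rewrite -tensZl; apply: tens_hull_tens => //=.
rewrite cseminormZ; have := rnorm_ge0 k; rewrite le_eqVlt => /predU1P[<-|k0].
  by rewrite mul0r.
by apply: lt_le_trans kde; rewrite ltr_pM2l.
Qed.

Lemma tens_hull_half (e : R) s t : H (e / 2) s -> H (e / 2) t -> 0 < e ->
  H e (s + t).
Proof.
move=> hs ht e0; have r2 : rnorm (2 : R[i]) = 2.
  by apply: complexI; rewrite -rnormE ger0_norm ?ler0n// rmorph_nat.
apply: (absconvex_half (@tens_hull_absconvex _ _ _ _ _)).
  by apply: (@tens_hull_scale _ (e / 2)) => //; rewrite r2 mulrC divfK ?pnatr_eq0.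
by apply: (@tens_hull_scale _ (e / 2)) => //; rewrite r2 mulrC divfK ?pnatr_eq0.
Qed.

(** For fixed [x], scale [x] into [V] and move the inverse scalar to the other factor. *)
Lemma tens_eventually_small x (e : R) : 0 < e ->
  exists2 d, 0 < d & forall y, p y < d -> H e (tens y x).
Proof.
move=> e0; have [r r0 Vrx] := nbhs0_absorbing x V0.
have rr0 : 0 < rnorm r by rewrite -ltcR -rnormE gtr0_norm.
exists (e * rnorm r) => [|y yd]; first exact: mulr_gt0.
have -> : tens y x = tens (r^-1 *: y) (r *: x).
  by rewrite tensZl tensZr scalerA mulVf ?gt_eqF// scale1r.
apply: tens_hull_tens => //=; rewrite cseminormZ.
have -> : rnorm r^-1 = (rnorm r)^-1.
  by apply: complexI; rewrite fmorphV -!rnormE normfV.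
by rewrite ltr_pdivrMl// mulrC.
Qed.

(* Sequences in Y (x) X modulo [bnull] receive the bilinear map sending (z, x)
   to the class of (y_n (x) x), where y_n in Y tends to z; this avoids completing
   Y (x)_A X. *)
Definition bnull : set (nat -> T) := [set s | forall e : R, 0 < e ->
  exists N, forall n, (N <= n)%N -> thicken (H e) span (s n)].

Lemma bnull_submodule : submodule bnull.
Proof.
have [S0 SD SZ] := balanced_span_submodule Y X.
split=> [e e0|s t s0 t0 e e0|k s s0 e e0].
- exists 0%N => n _; exists 0 => //; rewrite subrr -(tens0l Y (0 : X)).
  by apply: tens_hull_tens; [rewrite /= cseminorm0|exact: nbhs_singleton].
- have e20 : 0 < e / 2 by rewrite divr_gt0.
  have [N1 HN1] := s0 _ e20; have [N2 HN2] := t0 _ e20.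
  exists (maxn N1 N2) => n; rewrite geq_max => /andP[/HN1[a Sa sa] /HN2[b Sb tb]].
  exists (a + b); first exact: SD.
  have := tens_hull_half sa tb e0; congr (tens_hull _ _ _).
  by rewrite fctE; abel.
- have k0 := rnorm_ge0 k; have k1 : 0 < 1 + rnorm k by rewrite ltr_pwDl.
  have [|N HN] := s0 (e / (1 + rnorm k)); first exact: divr_gt0.
  exists N => n /HN[a Sa sa]; exists (k *: a); first exact: SZ.
  have -> : (k *: s) n - k *: a = k *: (s n - a) by rewrite scalerBr.
  apply: tens_hull_scale sa => //.
  rewrite mulrCA; apply: ler_piMr; first exact: ltW.
  by rewrite ler_pdivrMr// mul1r lerDr.
Qed.

Definition ntends (y : nat -> Y) (z : Z) := forall e : R, 0 < e ->
  exists N, forall n, (N <= n)%N -> rnorm (z - ninj p (y n)) < e.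

Local Notation B y x := (lproj bnull (fun n => tens ((y : nat -> Y) n) x)).

Lemma ntends_uniq y y' z x : ntends y z -> ntends y' z -> B y x = B y' x.
Proof.
move=> yz y'z; apply/lprojP; apply: sub_lspan => e e0.
have [d d0 dH] := tens_eventually_small x e0.
have d20 : 0 < d / 2 by rewrite divr_gt0.
have [N1 HN1] := yz _ d20; have [N2 HN2] := y'z _ d20.
exists (maxn N1 N2) => n; rewrite geq_max => /andP[/HN1 h1 /HN2 h2].
exists 0; first by have [] := balanced_span_submodule Y X.
have -> : ((fun n => tens (y n) x) - (fun n => tens (y' n) x)) n - 0 =
    tens (y n - y' n) x by rewrite tensBl subr0.
apply: dH; rewrite -rnorm_ninj ninjD ninjN.
have -> : ninj p (y n) - ninj p (y' n) = - (z - ninj p (y n)) + (z - ninj p (y' n)).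
  by abel.
by apply: le_lt_trans (rnormD _ _) _; rewrite rnormN [d]splitr ltrD.
Qed.

Lemma ntends_cst y : ntends (fun=> y) (ninj p y).
Proof. by move=> e e0; exists 0%N => n _; rewrite subrr /rnorm normr0. Qed.

Lemma ntendsD y z y' z' : ntends y z -> ntends y' z' ->
  ntends (fun n => y n + y' n) (z + z').
Proof.
move=> yz yz' e e0; have e20 : 0 < e / 2 by rewrite divr_gt0.
have [N1 HN1] := yz _ e20; have [N2 HN2] := yz' _ e20.
exists (maxn N1 N2) => n; rewrite geq_max => /andP[/HN1 h1 /HN2 h2].
have -> : z + z' - ninj p (y n + y' n) = (z - ninj p (y n)) + (z' - ninj p (y' n)).
  have -> : ninj p (y n + y' n) = ninj p (y n) + ninj p (y' n).
    exact: ninjD.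
  by abel.
by apply: le_lt_trans (rnormD _ _) _; rewrite [e]splitr ltrD.
Qed.

Lemma ntendsZ k y z : ntends y z -> ntends (fun n => k *: y n) (k *: z).
Proof.
move=> yz e e0; have k0 := rnorm_ge0 k.
have k1 : 0 < 1 + rnorm k by rewrite ltr_pwDl.
have [|N HN] := yz (e / (1 + rnorm k)); first exact: divr_gt0.
exists N => n /HN; rewrite ltr_pdivlMr// => h.
have -> : k *: z - ninj p (k *: y n) = k *: (z - ninj p (y n)).
  by rewrite scalerBr ninjZ.
rewrite rnormZ; apply: le_lt_trans h; rewrite mulrC ler_wpM2l ?rnorm_ge0//.
by rewrite lerDr.
Qed.

Lemma ntends_act y z a : ntends y z -> ntends (fun n => ract (y n) a) (ract z a).
Proof.
move=> yz e e0; have a0 := rnorm_ge0 a.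
have a1 : 0 < 1 + rnorm a by rewrite ltr_pwDl.
have [|N HN] := yz (e / (1 + rnorm a)); first exact: divr_gt0.
exists N => n /HN; rewrite ltr_pdivlMr// => h.
have -> : ract z a - ninj p (ract (y n) a) = ract (z - ninj p (y n)) a.
  by rewrite ninj_act ractDl -scaleN1r -ractZl scaleN1r.
apply: le_lt_trans (ncract_norm _ _) _; apply: le_lt_trans h.
by rewrite ler_wpM2l ?rnorm_ge0// lerDr.
Qed.

Lemma exists_ntends z : exists y, ntends y z.
Proof.
have /choice[y yz] (n : nat) : exists y, rnorm (z - ninj p y) < n.+1%:R^-1.
  by apply: ninj_dense; rewrite invr_gt0.
exists y => e e0; have [|k] := @exists_inv_lt R e%:C%C; first by rewrite ltcR.
rewrite -(@rmorph_nat R R[i] (real_complex R)) -fmorphV ltcR => ke.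
exists k => n kn; apply: lt_trans (yz n) _; apply: le_lt_trans ke.
by rewrite lef_pV2 ?posrE// ler_nat.
Qed.

(** A tensor that becomes small over the completion was small already, up to balancing. The lifted
    map [L] sends the image of [t] to the constant sequence [t], the balanced part to a sequence of
    balanced tensors, and the hull to sequences eventually in [H e]; comparing at one large index
    gives the claim. The second copy of [H e] pays for equality modulo [bnull]. *)
Lemma tensor_ninj_reflect (e : R) (t : T) : 0 < e ->
  thicken (tens_hull [set z : Z | rnorm z < e] V) (@balanced_span _ A Z X)
    (tensor_map (ninj p) t) ->
  exists2 s, thicken (H e) span (t - s) & H e s.
Proof.
move=> e0; have [N0 ND NZ] := bnull_submodule.
have /choice[rep repP] := exists_ntends.
have BD y y' x : B (fun n => y n + y' n) x = B y x + B y' x.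
  rewrite -lprojD; congr (lproj _ _); apply/funext => n.
  exact: tensDl.
have BZ k y x : B (fun n => k *: y n) x = k *: B y x.
  rewrite -[RHS]linearZ; congr (lproj _ _); apply/funext => n.
  exact: tensZl.
have [|||| L LE] := @tensor_lift _ Z X (lquot bnull) (fun z x => B (rep z) x).
- move=> z z' x; rewrite -BD; apply: ntends_uniq (repP _) _.
  by apply: ntendsD.
- move=> z x x'; rewrite -lprojD; congr (lproj _ _); apply/funext => n.
  exact: tensDr.
- move=> k z x; rewrite -BZ; apply: ntends_uniq (repP _) _.
  by apply: ntendsZ.
- move=> k z x; rewrite -[RHS]linearZ; congr (lproj _ _); apply/funext => n.
  exact: tensZr.
have Lcst s : L (tensor_map (ninj p) s) = lproj bnull (fun=> s).
  elim/tensor_ind: s => [|k y x s IH].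
    have -> : lproj bnull (fun=> 0 : T) = 0 by exact: (linear0 (lproj bnull)).
    by rewrite !linear0.
  have -> : lproj bnull (fun=> k *: tens y x + s) =
      k *: lproj bnull (fun=> tens y x) + lproj bnull (fun=> s).
    by rewrite -linearP.
  rewrite !linearP /= tensor_mapE LE IH; congr (_ *: _ + _).
  by apply: ntends_uniq (repP _) _; exact: ntends_cst.
have LD u v : L (u + v) = L u + L v by exact: (linearD L).
have LZ k u : L (k *: u) = k *: L u by exact: (linearZZ L).
have LB u v : L (u - v) = L u - L v by exact: (linearB L).
have piZ k s : lproj bnull (k *: s) = k *: lproj bnull s.
  exact: (linearZZ (lproj bnull)).
have Lspan r : balanced_span r ->
    exists2 s : nat -> T, L r = lproj bnull s & forall n, span (s n).
  have [S0 SD SZ] := balanced_span_submodule Y X.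
  pose P : set (tensor Z X) :=
    [set r | exists2 s : nat -> T, L r = lproj bnull s & forall n, span (s n)].
  have Pm : submodule P.
    split=> [|u v [s us Ss] [s' vs Ss']|k u [s us Ss]].
    - exists (fun=> 0) => [|n]; last exact: S0.
      by rewrite -(Lcst 0) [tensor_map _ _]linear0.
    - exists (s + s') => [|n]; last exact: SD.
      by rewrite LD us vs -lprojD.
    - exists (k *: s) => [|n]; last exact: SZ.
      by rewrite LZ us piZ.
  move=> /(_ P Pm); apply => _ [z [a [x ->]]].
  exists (fun n => tens (ract (rep z n) a) x - tens (rep z n) (lact a x)).
    (* The chosen sequence for [ract z a] is exchanged for [ract (rep z n) a], which has the same
       limit and makes each term a balancing relation. *)
    rewrite LB !LE (ntends_uniq x (repP _) (ntends_act a (repP z))).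
    by rewrite -linearB.
  by move=> n; apply: sub_lspan; exists (rep z n), a, x.
have Lhull h : tens_hull [set z : Z | rnorm z < e] V h ->
    exists2 s : nat -> T, L h = lproj bnull s &
      exists N, forall n, (N <= n)%N -> H e (s n).
  move: h; apply: tens_hull_sub.
    move=> a b u v ab [s us [N HN]] [s' vs [N' HN']].
    exists (a *: s + b *: s'); first by rewrite LD (LZ a) (LZ b) us vs lprojD (piZ a) (piZ b).
    exists (maxn N N') => n; rewrite geq_max => /andP[/HN h1 /HN' h2].
    exact: (tens_hull_absconvex ab h1 h2).
  move=> z x ze Vx; exists (fun n => tens (rep z n) x); first exact: LE.
  (* As [rnorm z < e] is strict, the approximants eventually satisfy it too, so [e] does not
     grow. *)
  have [|N HN] := repP z (e - rnorm z); first by rewrite subr_gt0.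
  exists N => n /HN h; apply: tens_hull_tens => //; rewrite /mkset -rnorm_ninj.
  have -> : ninj p (rep z n) = z - (z - ninj p (rep z n)) by abel.
  by apply: le_lt_trans (rnormD _ _) _; rewrite rnormN; lra.
move=> [r Rr hr]; have [s rs Ss] := Lspan _ Rr; have [s' hs [N HN]] := Lhull _ hr.
have : lproj bnull (fun=> t) = lproj bnull (s + s').
  by rewrite -Lcst lprojD -rs -hs -LD; congr (L _); abel.
move=> /lprojP; rewrite lspan_id; last exact: bnull_submodule.
move=> /(_ e e0)[M HM]; pose n := maxn N M.
have [r' Rr' hr'] := HM n (leq_maxr _ _).
exists (s' n); last by apply: HN; exact: leq_maxl.
exists (r' + s n); first by have [_ SD _] := balanced_span_submodule Y X; exact: SD.
have e1 : ((fun=> t) - (s + s')) n = t - (s n + s' n) by [].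
by move: hr'; rewrite e1; congr (tens_hull _ _ _); abel.
Qed.

End Reflection.

(** * Frechet modules *)

Section LocalEmbedding.
Context (R : realType) (A : banachAlgType R[i]) (X : banachLModType A).
Hypothesis Xflat : forall (Y1 Y2 Y3 : banachRModType A)
    (f : cmodmap Y1 Y2) (g : cmodmap Y2 Y3),
  short_exact f g -> short_exact (btensor_map X f) (btensor_map X g).

(** The embedding for one seminorm [q]: it holds for the completed map [F], and the square formed by
    [f], [F] and the maps into the completions commutes. Continuity of [q] carries the neighbourhood
    back to [Y2 (x) X], and [tensor_ninj_reflect] carries smallness back to [Y1 (x) X]. *)
Lemma local_embedding (Y1 Y2 : tvsRModType A) (f : cmodmap Y1 Y2)
    (q : cseminorm Y2) (V : set X) :
  nbhs (0 : Y2) [set y | q y < 1] -> nbhs 0 V ->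
  exists2 W, nbhs (0 : tensor Y2 X) W &
    forall t : tensor Y1 X, thicken W balanced_span (tensor_map f t) ->
    exists2 s, thicken (tens_hull [set y : Y1 | q (f y) < 1] V) balanced_span (t - s) &
      tens_hull [set y : Y1 | q (f y) < 1] V s.
Proof.
move=> q0 V0; have [F [G [FG Fi]]] := ncompl_exact f q.
have /btensor_embeddingE Fe := embedding_of_short_exact
  (@normed_countable_base _ _) (@normed_countable_base _ _)
  (@normed_countable_base _ X) (Xflat FG).
have [|W W0 WF] := Fe (tens_hull [set z | rnorm z < 1] V).
  by apply: nbhs0_tens_hull => //; apply/nbhs0_rnorm; exists 1.
have ic : continuous (ninj q : Y2 -> ncompl q).
  apply: linear_continuous0 => U /nbhs0_rnorm[e e0 eU].
  have := nbhs0_scale (e%:C%C)^-1 q0; apply: filterS => y /=.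
  rewrite cseminormZ => qy; apply: eU; rewrite rnorm_ninj.
  have er : rnorm (e%:C%C : R[i])^-1 = e^-1.
    by apply: complexI; rewrite fmorphV -rnormE normfV gtr0_norm// ltcR.
  by move: qy; rewrite er ltr_pdivrMl// mulr1.
pose i2 : cmodmap Y2 (ncompl q) := CModMap ic (@ninj_act _ _ _ q).
exists (tensor_map i2 @^-1` W).
  by apply: continuous_nbhs0 => //; exact: tensor_map_continuous.
move=> t [r Rr Wr]; apply: (tensor_ninj_reflect (p := comp_cseminorm f q)) => //.
apply: WF; exists (tensor_map i2 r); first exact: balanced_span_map.
have -> : tensor_map F (tensor_map (ninj (comp_cseminorm f q)) t) =
    tensor_map i2 (tensor_map f t).
  by apply: tensor_map_square => y; exact: Fi.
by rewrite -linearB.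
Qed.

End LocalEmbedding.

Section Frechet.
Context (R : realType).

Lemma frechet_countable_base (E : tvsType R[i]) : frechet_space E -> countable_base E.
Proof.
move=> [_ [p [_ pE]] _].
exists (fun k => [set x | forall n, (n <= k)%N -> p n x < k.+1%:R^-1]); split=> [k|U].
  by apply/pE; exists k, k.+1%:R^-1; split=> //; rewrite invr_gt0.
move=> /pE[N [e [e0 eU]]]; have [k ke] := exists_inv_lt e0.
exists (maxn N k) => x xp; apply: eU => n nN.
apply: lt_trans (xp n (leq_trans nN (leq_maxl _ _))) _.
by apply: le_lt_trans ke; rewrite lef_pV2 ?posrE// ler_nat ltnS leq_maxr.
Qed.

Lemma frechet_seq_complete (E : tvsType R[i]) : frechet_space E -> seq_complete E.
Proof. by case. Qed.

Lemma frechet_closed0 (E : tvsType R[i]) : frechet_space E -> closed [set (0 : E)].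
Proof. by move=> [Eh _ _]; exact/accessible_closed_set1/hausdorff_accessible. Qed.

Lemma frechet_real_seminorm (E : tvsType R[i]) (U : set E) : frechet_space E ->
  nbhs 0 U -> exists p : E -> R, [/\ forall x y, p (x + y) <= p x + p y,
    forall (k : R[i]) x, p (k *: x) = rnorm k * p x,
    nbhs 0 [set x | p x < 1] & [set x | p x < 1] `<=` U].
Proof.
move=> [_ [p [ps pE]] _] /pE[N [e [e0 eU]]].
have /complex_realP[r er] := gtr0_real e0; move: e0 eU; rewrite er ltcR => r0 eU.
have pR n x : p n x = (complex.Re (p n x))%:C%C.
  by have [p0 _ _] := ps n; rewrite RRe_real// ger0_real.
have pge n x : 0 <= complex.Re (p n x).
  by have [p0 _ _] := ps n; rewrite -ler0c -pR.
exists (fun x => \sum_(n < N.+1) complex.Re (p n x) / r); split.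
- move=> x y; rewrite -big_split ler_sum// => n _ /=.
  rewrite -mulrDl; apply: ler_wpM2r; first by rewrite invr_ge0 ltW.
  rewrite -lecR rmorphD /= -!pR.
  by have [_ pD _] := ps n; exact: pD.
- move=> k x; rewrite mulr_sumr; apply: eq_bigr => n _.
  rewrite mulrA; congr (_ / _); apply: complexI.
  have [_ _ h] := ps n; rewrite -pR h rnormE rmorphM.
  by congr (_ * _); exact: pR.
(* [N.+1] summands, each at most 1/(N+2), have a sum strictly below 1. *)
- apply/pE; exists N, (r / N.+2%:R)%:C%C; split; first by rewrite ltcR divr_gt0.
  move=> x xp /=; apply: (@le_lt_trans _ _ (\sum_(n < N.+1) N.+2%:R^-1)).
    apply: ler_sum => n _; rewrite ler_pdivrMr// mulrC -lecR -pR ltW//.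
    by apply: xp; rewrite -ltnS.
  rewrite sumr_const card_ord -[_ *+ N.+1]mulr_natr [_ * N.+1%:R]mulrC ltr_pdivrMr// mul1r.
  by rewrite ltr_nat.
- move=> x /= x1; apply: eU => n nN; rewrite pR ltcR.
  rewrite -[ltRHS]mul1r -ltr_pdivrMr//; apply: le_lt_trans x1.
  rewrite -ltnS in nN; rewrite (bigD1 (Ordinal nN))//= lerDl sumr_ge0// => i _.
  by rewrite divr_ge0// ltW.
Qed.

(** Take for [q y] the supremum of [p y] and of all [p (ya)] with [a] in the unit ball of [A]. It is
    contractive because the norm of [A] is submultiplicative; the term [p y] ensures [p <= q], as
    [A] may lack a unit. Joint continuity of the action at 0 makes [q] finite and continuous. *)
Lemma exists_cseminorm (A : banachAlgType R[i]) (Y : tvsRModType A) (U : set Y) :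
  frechet_space Y -> nbhs 0 U -> exists2 q : cseminorm Y,
    nbhs (0 : Y) [set y | q y < 1] & [set y | q y < 1] `<=` U.
Proof.
move=> Yf U0; have [p [pD pZ p1 pU]] := frechet_real_seminorm Yf U0.
have p0 : p 0 = 0 by have := pZ 0 0; rewrite scaler0 /rnorm normr0 mul0r.
have pN y : p (- y) = p y by rewrite -scaleN1r pZ /rnorm normrN1 mul1r.
have pge y : 0 <= p y.
  by have := pD y (- y); rewrite subrr p0 pN -mulr2n pmulrn_lge0.
have rinv (k : R[i]) : rnorm k^-1 = (rnorm k)^-1.
  by apply: complexI; rewrite fmorphV -!rnormE normfV.
have [P [d [P0 d0 Pd]]] : exists (P : set Y) (d : R), [/\ nbhs 0 P, 0 < d &
    forall y a, P y -> rnorm a <= 1 -> p (ract y a) <= d].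
  have := @ract_continuous _ _ Y (0, 0) [set y | p y < 1].
  have -> : ract (0, 0).1 (0, 0).2 = (0 : Y).
    have := ractZl (0 : R[i]) (0 : Y) (0 : A); rewrite !scale0r; exact.
  move=> /(_ p1)[[P Q] [/= P0 /nbhs0_rnorm[e e0 eQ]] PQ].
  (* Multiplication by [e / 2] moves the unit ball of [A] into [Q], where [p (ya) < 1]. *)
  exists P, (e / 2)^-1; split=> //; first by rewrite invr_gt0 divr_gt0.
  move=> y a Py a1; have e20 : 0 < e / 2 by rewrite divr_gt0.
  have /PQ /= : (P `*` Q) (y, (e / 2)%:C%C *: a).
    split=> //=; apply: eQ; rewrite rnormZ rnorm_real; last exact: ltW.
    apply: (@le_lt_trans _ _ (e / 2)); first by rewrite ler_piMr// ltW.
    by rewrite ltr_pdivrMr// ltr_pMr// ltr1n.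
  rewrite ractZr pZ rnorm_real; last exact: ltW.
  by rewrite -ltr_pdivlMl// mulr1 => /ltW.
pose S y : set R := [set r | r = p y \/ exists2 a : A, rnorm a <= 1 & r = p (ract y a)].
have Sb y : exists M, ubound (S y) M.
  have [s s0 Ps] := nbhs0_absorbing y P0.
  have s0' : 0 < rnorm s by rewrite -ltcR -rnormE gtr0_norm.
  exists (p y + d / rnorm s) => _ [->|[a a1 ->]].
    by rewrite lerDl divr_ge0// ltW.
  rewrite -[leLHS]add0r lerD// ler_pdivlMr// mulrC -pZ -ractZl.
  exact: Pd.
have Sy y : S y (p y) by left.
have Sa y a : rnorm a <= 1 -> S y (p (ract y a)) by right; exists a.
pose q y := sup (S y).
have qub y r : S y r -> r <= q y.
  by move=> Sr; apply: ub_le_sup => //; exact: Sb.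
have qle y c : p y <= c -> (forall a, rnorm a <= 1 -> p (ract y a) <= c) -> q y <= c.
  move=> yc ac; apply: ge_sup; first by exists (p y).
  by move=> _ [->//|[a a1 ->]]; exact: ac.
have qge y : 0 <= q y by apply: le_trans (qub _ _ (Sy y)).
have qD x y : q (x + y) <= q x + q y.
  apply: qle => [|a a1].
    by apply: le_trans (pD _ _) _; apply: lerD; exact: qub.
  by rewrite ractDl; apply: le_trans (pD _ _) _; apply: lerD; apply: qub; exact: Sa.
have qZ_le (k : R[i]) y : q (k *: y) <= rnorm k * q y.
  apply: qle => [|a a1].
    by rewrite pZ ler_wpM2l ?rnorm_ge0//; exact: qub.
  by rewrite ractZl pZ ler_wpM2l ?rnorm_ge0//; apply: qub; exact: Sa.
have qZ (k : R[i]) y : q (k *: y) = rnorm k * q y by exact: semi_homogeneous.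
have qb y b : p (ract y b) <= q y * rnorm b.
  have := rnorm_ge0 b; rewrite le_eqVlt => /predU1P[b0|b0].
    have -> : b = 0 by apply/eqP; rewrite -normr_eq0 rnormE -b0.
    have -> : ract y 0 = 0 by have := ractZr (0 : R[i]) y 0; rewrite !scale0r.
    by rewrite p0 mulr_ge0// rnorm_ge0.
  have bc : rnorm ((rnorm b)%:C%C : R[i]) = rnorm b by rewrite rnorm_real// ltW.
  rewrite -ler_pdivrMr// mulrC -[in leLHS]bc -rinv -pZ -ractZr; apply/qub/Sa.
  by rewrite rnormZ rinv bc mulVf// gt_eqF.
have q_act y a : q (ract y a) <= q y * rnorm a.
  apply: qle => // b b1; rewrite ractA; apply: le_trans (qb _ _) _.
  rewrite ler_wpM2l//; apply: (@le_trans _ _ (rnorm a * rnorm b)).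
    by have := bmul_norm a b; rewrite !rnormE -rmorphM lecR.
  by rewrite ler_piMr// rnorm_ge0.
suff q1 : nbhs (0 : Y) [set y | q y < 1].
  exists (CSeminorm qD qZ q_act) => //.
  by move=> y /= qy; apply: pU => /=; exact: le_lt_trans (qub _ _ (Sy y)) qy.
(* Scaling by [2 (1 + d)] brings both kinds of members of [S y], bounded by 1 and by [d] before
   scaling, down to at most 1/2; the supremum is then strictly below 1. *)
have c0 : 0 < 1 + d by rewrite addr_gt0.
have cc : rnorm ((2 * (1 + d))%:C%C : R[i]) = 2 * (1 + d).
  by rewrite rnorm_real// mulr_ge0// ltW.
have Q1 : nbhs (0 : Y) [set y | P ((2 * (1 + d))%:C%C *: y)] by exact: nbhs0_scale.
have Q2 : nbhs (0 : Y) [set y | p ((2 * (1 + d))%:C%C *: y) < 1].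
  exact: (@nbhs0_scale _ _ _ [set y | p y < 1]).
apply: filterS (filterI Q1 Q2) => y /= [Py py]; apply: (@le_lt_trans _ _ 2^-1); last by rewrite invf_lt1 ?ltr1n.
have d2 : 0 < 2 * (1 + d) by rewrite mulr_gt0.
apply: qle => [|a a1].
  move: py; rewrite pZ cc -ltr_pdivlMl// mulr1 invfM => /ltW /le_trans; apply.
  apply: ler_piMr; first by rewrite invr_ge0.
  by rewrite invf_le1// lerDl ltW.
have := Pd _ a Py a1; rewrite ractZl pZ cc -ler_pdivlMl// => /le_trans; apply.
rewrite invfM -mulrA; apply: ler_piMr; first by rewrite invr_ge0.
by rewrite mulrC ler_pdivrMr// mul1r lerDr.
Qed.

End Frechet.

(** The open mapping theorem for [f] onto the kernel of [g] gives a neighbourhood [P] in [Y2] whose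
    preimage lies in [U], hence a contractive [q] on [Y2] whose restriction to [Y1] controls [U].
    The two small terms of [local_embedding] account for the halving of [W]. *)
Lemma frechet_embedding (R : realType) (A : banachAlgType R[i]) (X : banachLModType A)
    (Y1 Y2 Y3 : tvsRModType A) (f : cmodmap Y1 Y2) (g : cmodmap Y2 Y3) :
  (forall (Z1 Z2 Z3 : banachRModType A) (F : cmodmap Z1 Z2) (G : cmodmap Z2 Z3),
    short_exact F G -> short_exact (btensor_map X F) (btensor_map X G)) ->
  frechet_space Y1 -> frechet_space Y2 -> frechet_space Y3 -> short_exact f g ->
  btensor_embedding X f.
Proof.
move=> Xflat Y1f Y2f Y3f [fi fg _] W /nbhs0_half[W1 [W10 W1W _]].
have [U [V [U0 V0 UVW]]] := nbhs0_tensE W10.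
pose D : set Y2 := [set z | g z = 0].
have Dm : submodule D by exact: (submodule_preimage g (submodule0 Y3)).
have Dc : closed D.
  apply: (@closed_comp _ _ g [set 0]); last exact: frechet_closed0.
  by move=> z _; exact: cmodmap_continuous.
have Df y : D (f y).
  by have : range f (f y) by [exists y]; rewrite fg.
have Dlift z : D z -> exists y, [set 0] (z - f y).
  move=> Dz; have [y _ <-] : range f z by rewrite fg.
  by exists y; rewrite /= subrr.
have D0 : [set 0] `<=` D by move=> _ ->; have [] := Dm.
have [P P0 PE] := open_mapping (@cmodmap_continuous _ _ _ _ f)
  (frechet_countable_base Y1f) (frechet_seq_complete Y1f)
  (frechet_countable_base Y2f) (frechet_seq_complete Y2f)
  (submodule0 Y2) (frechet_closed0 Y2f) Dm Dc Df D0 Dlift U0.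
have [q q1 qP] := exists_cseminorm Y2f P0.
have qU : [set y | q (f y) < 1] `<=` U.
  move=> y /qP Pfy; have [x Ux /eqP] := PE _ Pfy (Df y).
  by rewrite subr_eq0 => /eqP /fi ->.
have [W' W'0 W'E] := local_embedding Xflat f q1 V0.
exists W' => // t /W'E[s [r Rr hr] hs]; exists r => //.
have -> : t - r = (t - s - r) + s by rewrite addrAC subrK.
by apply: W1W; apply: UVW; [move: hr|move: hs]; exact: tens_hull_mono.
Qed.

Theorem proposition4p4 (R : realType) (A : banachAlgType R[i])
    (X : banachLModType A) :
  (forall (Y1 Y2 Y3 : tvsRModType A) (f : cmodmap Y1 Y2) (g : cmodmap Y2 Y3),
     frechet_space Y1 -> frechet_space Y2 -> frechet_space Y3 ->
     short_exact f g ->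
     short_exact (btensor_map X f) (btensor_map X g))
  <->
  (forall (Y1 Y2 Y3 : banachRModType A) (f : cmodmap Y1 Y2) (g : cmodmap Y2 Y3),
     short_exact f g ->
     short_exact (btensor_map X f) (btensor_map X g)).
Proof.
split=> [Xf Y1 Y2 Y3 f g fg|Xf Y1 Y2 Y3 f g Y1f Y2f Y3f fg].
  by apply: Xf fg; exact: banach_frechet.
have [_ fgE gs] := fg.
have g_open U : nbhs (0 : Y2) U -> exists2 V, nbhs (0 : Y3) V &
    forall y, V y -> exists2 z, U z & g z = y.
  have lift z : setT z -> exists y, [set 0] (z - g y).
    by rewrite -gs => -[y _ <-]; exists y; rewrite /= subrr.
  move=> /(open_mapping (@cmodmap_continuous _ _ _ _ g)
    (frechet_countable_base Y2f) (frechet_seq_complete Y2f)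
    (frechet_countable_base Y3f) (frechet_seq_complete Y3f)
    (submodule0 Y3) (frechet_closed0 Y3f) (submoduleT Y3) closedT (fun=> I) (fun _ _ => I) lift)[V V0 VE].
  exists V => // y Vy; have [z Uz /eqP] := VE y Vy I.
  by rewrite subr_eq0 => /eqP yz; exists z.
apply: (short_exact_of_embedding (frechet_countable_base Y1f)
  (frechet_countable_base Y2f) (frechet_countable_base Y3f)
  (@normed_countable_base _ X) fgE gs g_open).
by apply/btensor_embeddingE; exact: frechet_embedding Xf Y1f Y2f Y3f fg.
Qed.
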